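(* There exists a family of complex polynomials $(P_x)_{x\in\Theta}$, where $\Theta$ is an unbounded curve in the complex plane and $\deg(P_x)=3$, such that for each $x\in\Theta$ the ODE $$y''(z)+P_x(z)y(z)=0$$ has a nontrivial solution with infinitely many real zeros and finitely many non-real zeros. In addition, for some value $x_{crit}$ of the parameter, the number of non-real zeros is even and they are symmetric with respect to the real axis.
   Context: Zeros are zeros in $\mathbb{C}$ of the (entire) solution $y$ of the ODE. *)

(* Defs.v *)
From HB Require Import structures.
From mathcomp Require Import all_boot all_order all_algebra.
From mathcomp Require Import all_classical all_reals all_analysis.
From mathcomp Require Export complex.
Set Implicit Arguments.
Unset Strict Implicit.
Unset Printing Implicit Defensive.
Import Order.TTheory GRing.Theory Num.Theory.
Import numFieldNormedType.Exports.
Local Open Scope classical_set_scope.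
Local Open Scope ring_scope.

(* The field of complex numbers over R : realType is R[i].  The definitions are
   stated for K : numClosedFieldType, to be used at K := R[i], because the
   topology and the normed K-module structure of K on itself are inferred for
   an abstract K but not directly for R[i].  For y : K -> K, [derivable y z 1]
   is complex differentiability at z and [derive1 y] is the complex derivative. *)

(* A curve is the image of an interval, of any kind, under a continuous map. *)
Definition is_curve (R : realType) (K : numClosedFieldType) (Theta : set K) :
    Prop :=
  exists (I : interval R) (gamma : R -> K),
    {within [set` I], continuous gamma} /\ Theta = gamma @` [set` I].

Definition unbounded (K : numClosedFieldType) (Theta : set K) : Prop :=
  ~ bounded_set Theta.

(* y'' + P y = 0 on the whole complex plane.  The library derivative is total,
   hence the two differentiability conditions. *)
Definition solution (K : numClosedFieldType) (P : {poly K}) (y : K -> K) :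
    Prop :=
  [/\ forall z, derivable y z 1,
      forall z, derivable (derive1 y) z 1
    & forall z, derive1n 2 y z + P.[z] * y z = 0].

Definition nontrivial (K : numClosedFieldType) (y : K -> K) : Prop :=
  exists z, y z != 0.

(* In R[i], [Num.real] holds exactly when the imaginary part is zero.  Zeros are
   taken as points: those of a nontrivial solution are all simple. *)
Definition real_zeros (K : numClosedFieldType) (y : K -> K) : set K :=
  [set z | z \is Num.real /\ y z = 0].

Definition nonreal_zeros (K : numClosedFieldType) (y : K -> K) : set K :=
  [set z | z \isn't Num.real /\ y z = 0].

Definition almost_all_real_solution (K : numClosedFieldType) (P : {poly K})
    (y : K -> K) : Prop :=
  [/\ solution P y,
      nontrivial y,
      infinite_set (real_zeros y)
    & finite_set (nonreal_zeros y)].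

(* Main.v *)
Require Import Defs.
From HB Require Import structures.
From mathcomp Require Import all_boot all_order all_algebra finmap.
From mathcomp Require Import all_classical all_reals all_analysis.
From mathcomp Require Import ring lra.

(** The equation is [y'' = Q y] with [Q z = e z^3 + z^2 + E], that is [P = - Q],
    for real [e > 0] and [E].  On the imaginary axis [f t = y (i t)] satisfies
    [f'' = (t^2 - E + i e t^3) f], a perturbation of the harmonic oscillator
    which is symmetric under complex conjugation combined with [t -> - t].  The
    curve is a half-line of large real [x], with [e = 1 / x] and [E] an
    eigenvalue in [0, 7/4]; the solution is a real eigenfunction, recessive
    towards [+ i oo] and, by symmetry, towards [- i oo].

    Everything rests on one identity ([flux_derive]): along a straight line of
    direction [d], the flux [Re (Om y' (conj y))] has derivative
      [Re (Om (conj d)) |y'|^2 + Re (Om d Q) |y|^2].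
    Wherever both coefficients are nonnegative the flux is nondecreasing, and it
    vanishes at the zeros of [y].  No asymptotic expansion is needed.

    Existence of the eigenfunction ([exists_recessive]).  The solution which
    vanishes at [i N] is, up to a factor, real as soon as its flux [Om = i]
    vanishes at the origin.  That flux is nonpositive for [E = 0], by
    monotonicity ([mismatch_le0]).  For [E = 7/4], small [e] and arbitrarily
    large [N] it is nonnegative ([mismatch_ge0]), because in the limit [e = 0],
    [N = oo] the recessive solution of the oscillator is strictly increasing at
    the origin: 7/4 lies between the energies 1 and 3 of its first even and odd
    eigenfunctions.  The intermediate value theorem in [E] yields a real
    solution vanishing at [i N] for infinitely many [N], and a limit for
    [N -> oo] is the eigenfunction: its flux is nonpositive on the upper
    imaginary axis for [Om = 1], and above [2 i] for [Om = i].

    Non-real zeros are bounded ([nonreal_zeros_bounded]).  From a zero in the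
    upper half-plane one follows a path, of one or two segments, along which the
    flux strictly increases from 0.  If the path ends on the imaginary axis this
    contradicts the eigenfunction property; this excludes all distant zeros
    except in two wedges.  In the wedge around the positive axis, the paths
    begin or end on that axis, where [y] is real.  In the wedge around the
    negative axis, where real zeros abound, [y] is compared with a solution
    [phi] vanishing at a far point of the upper half-plane: [|phi|] decreases
    strictly along vertical segments that cross the wedge, whereas the Wronskian
    of [y] and [phi] would give [phi] equal moduli at a non-real zero of [y] and
    at its conjugate.

    Finally, zeros are isolated, so the bounded set of non-real zeros is finite;
    it is symmetric because [y] is real, hence of even cardinality; and on the
    negative axis [Q] tends to [- oo], so [y] oscillates. *)

Set Implicit Arguments.
Unset Strict Implicit.
Unset Printing Implicit Defensive.
Import Order.TTheory GRing.Theory Num.Theory.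
Import numFieldNormedType.Exports.
Local Open Scope classical_set_scope.
Local Open Scope ring_scope.
Local Open Scope complex_scope.
Local Notation "z ^*" := (conjc z) : ring_scope.

(** * Real calculus *)

Section RealCalculus.
Context {R : realType}.
Implicit Types (f df v dv : R -> R) (a b : R).

Lemma is_derive_within f df a b :
  (forall x : R, a <= x -> x <= b -> is_derive x 1 f (df x)) ->
  {within `[a, b], continuous f}.
Proof.
move=> fd; apply: derivable_within_continuous => x.
by rewrite in_itv /= => /andP[ax xb]; case: (fd x ax xb).
Qed.

Lemma is_derive_nondecreasing f df a b : a <= b ->
  (forall x : R, a <= x -> x <= b -> is_derive x 1 f (df x)) ->
  (forall x, a <= x -> x <= b -> 0 <= df x) -> f a <= f b.
Proof.
rewrite le_eqVlt => /orP[/eqP-> //|ab] fd df0.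
have fd' x : x \in `]a, b[ -> is_derive x 1 f (df x).
  by rewrite in_itv /= => /andP[ax xb]; exact: fd (ltW ax) (ltW xb).
have [c] := @MVT R f df a b ab fd' (is_derive_within fd).
rewrite in_itv /= => /andP[ac cb] e.
by rewrite -subr_ge0 e mulr_ge0 ?subr_ge0 ?(ltW ab)// df0 ?ltW.
Qed.

Lemma is_derive_increasing f df a b : a < b ->
  (forall x : R, a <= x -> x <= b -> is_derive x 1 f (df x)) ->
  (forall x, a <= x -> x <= b -> 0 <= df x) -> 0 < df a -> f a < f b.
Proof.
move=> ab fd df0 dfa.
have [fad fae] := fd a (lexx _) (ltW ab).
have dfa_lim : h^-1 *: (f (h%:A + a) - f a) @[h --> 0^'] --> df a.
  by rewrite -fae; exact: fad.
have /cvgrPdist_lt := dfa_lim => /(_ (df a) dfa).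
rewrite near_withinE => /nbhs_ballP[d /= d0 H].
pose h := Num.min (d / 2) (b - a).
have h0 : 0 < h by rewrite lt_min divr_gt0//= subr_gt0.
have hd : h < d by rewrite /h gt_min; apply/orP; left; lra.
have hb : a + h <= b by rewrite -lerBrDl /h ge_min lexx orbT.
have ah : f a < f (a + h).
  have /(_ h) := H; rewrite -ball_normE /= sub0r normrN gtr0_norm// => /(_ hd).
  rewrite gt_eqF// => /(_ isT).
  rewrite [_ *: _]mulrC [h%:A]mulr1 => /ltr_distlBl; rewrite subrr.
  by rewrite pmulr_lgt0 ?invr_gt0// subr_gt0 addrC.
apply: lt_le_trans ah _; apply: is_derive_nondecreasing hb _ _ => x ax xb.
- by apply: fd => //; lra.
- by apply: df0 => //; lra.
Qed.

Lemma is_derive0_cst f a b : (forall x : R, is_derive x 1 f 0) -> f a = f b.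
Proof.
move=> fd; have le x y : x <= y -> f x = f y.
  move=> xy; apply/eqP; rewrite eq_le; apply/andP; split.
    by apply: (@is_derive_nondecreasing f (fun=> 0)).
  rewrite -lerN2; apply: (@is_derive_nondecreasing (fun t => - f t) (fun=> 0)) => //.
  by move=> t _ _; rewrite -[0]oppr0; exact: is_deriveN.
by have [/le//|/ltW/le] := lerP a b.
Qed.

(** Such a [v] becomes negative, and from then on [1 / v] grows at least
    linearly, hence becomes positive. *)
Lemma riccati_blowup v dv a :
  (forall t : R, a <= t -> is_derive t 1 v (dv t)) ->
  (forall t, a <= t -> dv t <= - 2^-1 - v t ^+ 2) -> False.
Proof.
move=> vd dvle.
have vlin t : a <= t -> v t <= v a - 2^-1 * (t - a).
  move=> at_; pose g x := v a - 2^-1 * (x - a) - v x.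
  suff : g a <= g t by rewrite /g subrr; lra.
  apply: (@is_derive_nondecreasing g (fun t => - 2^-1 - dv t)) at_ _ _ => x ax _.
    have := vd x ax => ?.
    by apply: is_derive_eq; rewrite /GRing.scale /=; lra.
  by have := dvle x ax; have := sqr_ge0 (v x); lra.
pose b := a + 2 * `|v a| + 2.
have va : v a <= `|v a| := ler_norm _.
have va0 := normr_ge0 (v a).
have ab : a <= b by rewrite /b; lra.
have vneg t : b <= t -> v t < 0.
  move=> bt; have := vlin t (le_trans ab bt); move: bt; rewrite /b; lra.
have wlin t : b <= t -> (v b)^-1 + (t - b) <= (v t)^-1.
  move=> bt; pose g x := (v x)^-1 - x.
  suff : g b <= g t by rewrite /g; lra.
  apply: (@is_derive_nondecreasing g (fun t => - (v t) ^- 2 * dv t - 1)) bt _ _ => x bx _.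
    have vx := vneg x bx; have := vd x (le_trans ab bx) => ?.
    have vx0 : v x != 0 by rewrite lt_eqF.
    by apply: is_derive_eq; rewrite /GRing.scale /=; lra.
  have vx := vneg x bx.
  have v2 : 0 < v x ^+ 2 by rewrite exprn_even_gt0//= lt_eqF.
  rewrite subr_ge0 mulNr -mulrN ler_pdivlMl// mulr1.
  by have := dvle x (le_trans ab bx); lra.
have w0 : (v b)^-1 < 0 by rewrite invr_lt0 vneg.
have bt : b <= b - (v b)^-1 by lra.
have := wlin _ bt; have : (v (b - (v b)^-1))^-1 < 0 by rewrite invr_lt0 vneg.
lra.
Qed.

End RealCalculus.

(** * Complex moduli and complex derivatives *)

(** Over an abstract field, so that its topology is the one of [derivable];
    for [R[i]] only the modulus [cabs], with values in [R], is used below. *)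
Definition has_derivative (K : numClosedFieldType) (f : K -> K) (z l : K) :=
  derivable f z 1 /\ derive1 f z = l.

Lemma has_derivative_quotient (K : numClosedFieldType) (f : K -> K) (z l : K) :
  (forall e, 0 < e -> exists2 d, 0 < d & forall h, h != 0 -> `|h| < d ->
     `|h^-1 * (f (h + z) - f z) - l| < e) ->
  has_derivative f z l.
Proof.
move=> H.
have lim1 : h^-1 *: (f (h + z) - f z) @[h --> 0^'] --> l.
  apply/cvgrPdist_lt => e e0; have [d d0 dP] := H e e0.
  rewrite near_withinE; apply/nbhs_ballP; exists d => //= h.
  rewrite -ball_normE /= sub0r normrN => hd h0.
  by rewrite distrC; exact: dP.
have lim2 : h^-1 *: (f (h%:A + z) - f z) @[h --> 0^'] --> l.
  by under eq_fun => h do rewrite [h%:A]mulr1.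
split; first by apply/cvg_ex; exists l.
exact: cvg_lim lim1.
Qed.

Section ComplexNorm.
Context {R : realType}.
Implicit Types (x y z w : R[i]) (a b r : R).

Definition cabs z : R := Normc.normc z.

Lemma normcabs z : `|z| = (cabs z)%:C.
Proof. by rewrite normc_def /cabs; case: z. Qed.

Lemma cabs_ge0 z : 0 <= cabs z.
Proof. by rewrite -ler0c -normcabs. Qed.

Lemma cabs0 : cabs 0 = 0. Proof. exact: Normc.normc0. Qed.

Lemma cabsM z w : cabs (z * w) = cabs z * cabs w.
Proof. exact: Normc.normcM. Qed.

Lemma cabsX z n : cabs (z ^+ n) = cabs z ^+ n.
Proof.
by elim: n => [|n IH]; rewrite ?expr0 /cabs ?Normc.normc1// !exprS -/(cabs _) cabsM IH.
Qed.

Lemma cabsD z w : cabs (z + w) <= cabs z + cabs w.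
Proof. exact: le_normcD. Qed.

Lemma cabsN z : cabs (- z) = cabs z. Proof. exact: normcN. Qed.

Lemma cabs_eq0 z : (cabs z == 0) = (z == 0).
Proof.
by apply/eqP/eqP => [/Normc.eq0_normc//|->]; exact: cabs0.
Qed.

Lemma cabs_real r : cabs r%:C = `|r|.
Proof. by rewrite /cabs /= expr0n /= addr0 sqrtr_sqr. Qed.

Lemma cabsMr r z : cabs (r%:C * z) = `|r| * cabs z.
Proof. by rewrite cabsM cabs_real. Qed.

Lemma cabs_nat n : cabs (n%:R : R[i]) = n%:R.
Proof.
have -> : (n%:R : R[i]) = (n%:R : R)%:C by rewrite rmorph_nat.
by rewrite cabs_real normr_nat.
Qed.

Lemma cabs_sqr z : cabs z ^+ 2 = complex.Re z ^+ 2 + complex.Im z ^+ 2.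
Proof. by case: z => a b /=; rewrite sqr_sqrtr// addr_ge0// sqr_ge0. Qed.

Lemma Re_cabs z : `|complex.Re z| <= cabs z.
Proof.
rewrite -(@ler_pXn2r _ 2) ?nnegrE ?cabs_ge0//.
by rewrite cabs_sqr real_normK ?num_real// lerDl sqr_ge0.
Qed.

Lemma Im_cabs z : `|complex.Im z| <= cabs z.
Proof.
rewrite -(@ler_pXn2r _ 2) ?nnegrE ?cabs_ge0//.
by rewrite cabs_sqr real_normK ?num_real// lerDr sqr_ge0.
Qed.

Lemma cabs_ReIm z : cabs z <= `|complex.Re z| + `|complex.Im z|.
Proof.
rewrite -(@ler_pXn2r _ 2) ?nnegrE ?cabs_ge0 ?addr_ge0//.
rewrite cabs_sqr -(real_normK (num_real (complex.Re z))).
rewrite -(real_normK (num_real (complex.Im z))) sqrrD -addrA.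
by rewrite lerD2l lerDr mulrn_wge0// mulr_ge0.
Qed.

Lemma cabs_conj z : cabs z^* = cabs z.
Proof. by case: z => a b; rewrite /cabs /= sqrrN. Qed.

Lemma cabsV z : cabs z^-1 = (cabs z)^-1.
Proof. exact: Normc.normcV. Qed.

End ComplexNorm.
Arguments cabs {R} z : simpl never.

Section ComplexDerivative.
Context {R : realType}.
Implicit Types (F G : R[i] -> R[i]) (z w : R[i]).

(** The quadratic bound on the remainder is what a convergent power series
    gives; it is stronger than differentiability and needs no limits. *)
Definition cderiv F F1 := forall z, exists2 B : R, 0 <= B & forall h, cabs h <= 1 ->
  cabs (F (z + h) - F z - h * F1 z) <= B * cabs h ^+ 2.

Lemma cderiv_has_derivative F F1 : cderiv F F1 ->
  forall z, @has_derivative R[i] F z (F1 z).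
Proof.
move=> dF z; apply: has_derivative_quotient => e e0.
have [B B0 HB] := dF z.
have eE : e = (complex.Re e)%:C.
  by case: e e0 => a b; rewrite ltcE /= => /andP[/eqP-> _].
move: e0; rewrite eE ltcR => e0.
set e' := complex.Re e in e0 *.
have B1 : 0 < B + 1 by lra.
pose d := Num.min 1 (e' / (B + 1)).
have d0 : 0 < d by rewrite lt_min ltr01 divr_gt0.
exists d%:C; rewrite ?ltcR// => h h0.
rewrite !normcabs !ltcR lt_min => /andP[h1 he].
have ah0 : 0 < cabs h by rewrite lt_def cabs_ge0 cabs_eq0 h0.
have -> : h^-1 * (F (h + z) - F z) - F1 z = h^-1 * (F (z + h) - F z - h * F1 z).
  by rewrite [h + z]addrC [RHS]mulrBr mulKf.
rewrite cabsM cabsV ltr_pdivrMl//; apply: le_lt_trans (HB h (ltW h1)) _.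
rewrite mulrC expr2 -mulrA ltr_pM2l//.
move: he; rewrite ltr_pdivlMr//; nra.
Qed.

Lemma cderiv_cont F F1 z : cderiv F F1 ->
  exists2 B : R, 0 <= B & forall h, cabs h <= 1 -> cabs (F (z + h) - F z) <= B * cabs h.
Proof.
move=> /(_ z)[B B0 HB]; exists (B + cabs (F1 z)) => [|h h1].
  by rewrite addr_ge0// cabs_ge0.
have -> : F (z + h) - F z = (F (z + h) - F z - h * F1 z) + h * F1 z by ring.
apply: le_trans (cabsD _ _) _; rewrite cabsM.
apply: le_trans (lerD (HB h h1) (lexx _)) _.
rewrite mulrDl [cabs h * _]mulrC lerD2r ler_wpM2l// expr2 ler_piMl ?cabs_ge0//.
Qed.

Lemma is_derive_quadratic (f : R -> R) (x l B : R) : 0 <= B ->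
  (exists2 d, 0 < d & forall h, `|h| < d -> `|f (x + h) - f x - h * l| <= B * h ^+ 2) ->
  is_derive x 1 f l.
Proof.
move=> B0 [d d0 H].
have lim2 : h^-1 *: (f (h%:A + x) - f x) @[h --> 0^'] --> l.
  apply/cvgrPdist_lt => e e0.
  have B1 : 0 < B + 1 by lra.
  rewrite near_withinE; apply/nbhs_ballP; exists (Num.min d (e / (B + 1))) => /=.
    by rewrite lt_min d0 divr_gt0.
  move=> h; rewrite -ball_normE /= sub0r normrN lt_min => /andP[hd he] h0.
  rewrite distrC [_ *: _]mulrC [h%:A]mulr1 mulrC [h + x]addrC.
  have -> : h^-1 * (f (x + h) - f x) - l = h^-1 * (f (x + h) - f x - h * l).
    by rewrite [RHS]mulrBr mulKf.
  have ah0 : 0 < `|h| by rewrite normr_gt0.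
  rewrite normrM normfV ltr_pdivrMl//; apply: le_lt_trans (H h hd) _.
  rewrite -(real_normK (num_real h)) mulrC expr2 -mulrA ltr_pM2l//.
  move: he; rewrite ltr_pdivlMr//; nra.
by split; [apply/cvg_ex; exists l|exact: cvg_lim lim2].
Qed.

Lemma is_derive_line F F1 z (d : R[i]) (x : R) : cderiv F F1 ->
  is_derive x 1 (fun r : R => complex.Re (F (z + r%:C * d))) (complex.Re (d * F1 (z + x%:C * d)))
  /\ is_derive x 1 (fun r : R => complex.Im (F (z + r%:C * d))) (complex.Im (d * F1 (z + x%:C * d))).
Proof.
move=> /(_ (z + x%:C * d))[B B0 HB].
have B0' : 0 <= B * cabs d ^+ 2 by rewrite mulr_ge0// exprn_ge0// cabs_ge0.
have d1 : 0 < cabs d + 1 by have := cabs_ge0 d; lra.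
have main h : `|h| < (cabs d + 1)^-1 ->
    cabs (F (z + (x + h)%:C * d) - F (z + x%:C * d) - h%:C * (d * F1 (z + x%:C * d)))
    <= B * cabs d ^+ 2 * h ^+ 2.
  move=> hd; rewrite [h%:C * (d * _)]mulrA rmorphD mulrDl [z + (_ + _)]addrA.
  have -> : B * cabs d ^+ 2 * h ^+ 2 = B * cabs (h%:C * d) ^+ 2.
    by rewrite cabsMr exprMn real_normK ?num_real//; ring.
  apply: HB; rewrite cabsMr.
  move: hd; rewrite -[X in _ < X]mul1r ltr_pdivlMr//.
  by have := normr_ge0 h; nra.
split; apply: is_derive_quadratic B0' _; exists (cabs d + 1)^-1; rewrite ?invr_gt0// => h hd.
- apply: le_trans (main h hd); apply: le_trans (Re_cabs _).
  by rewrite le_eqVlt; apply/orP; left; apply/eqP; congr (`|_|);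
    case: (F (z + _)) => ? ?; case: (F (z + _)) => ? ?; case: (d * _) => ? ? /=; ring.
- apply: le_trans (main h hd); apply: le_trans (Im_cabs _).
  by rewrite le_eqVlt; apply/orP; left; apply/eqP; congr (`|_|);
    case: (F (z + _)) => ? ?; case: (F (z + _)) => ? ?; case: (d * _) => ? ? /=; ring.
Qed.

End ComplexDerivative.

(** * Entire power series *)

Section PowerSeries.
Context {R : realType}.
Implicit Types (u v c : nat -> R[i]) (z h : R[i]) (B r : R) (n : nat).

Lemma half_pow_lt B (e : R) : 0 < e -> exists n, B / 2 ^+ n < e.
Proof.
move=> e0.
have [B0|B0] := lerP B 0.
  by exists 0%N; rewrite expr0 divr1; lra.
exists (Num.truncn (B / e)).+1.
rewrite ltr_pdivrMr ?exprn_gt0// mulrC -ltr_pdivrMr//.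
apply: lt_le_trans (truncnS_gt _) _.
by rewrite -natrX ler_nat ltnW// ltn_expl.
Qed.

Lemma le0_of_half_pow B (x : R) : (forall n, x <= B / 2 ^+ n) -> x <= 0.
Proof.
move=> H; rewrite leNgt; apply/negP => /(half_pow_lt B)[n].
by rewrite ltNge H.
Qed.

Lemma rsum_tail (a : R ^nat) B : (forall n, `|a n| <= B / 2 ^+ n) ->
  forall n, `|limn (series a) - series a n| <= 2 * B / 2 ^+ n.
Proof.
move=> aB n.
have B0 : 0 <= B by have := aB 0%N; rewrite expr0 divr1; apply: le_trans.
have part m : (n <= m)%N -> `|series a m - series a n| <= 2 * B / 2 ^+ n - 2 * B / 2 ^+ m.
  elim: m => [|m IH]; first by rewrite leqn0 => /eqP->; rewrite !subrr normr0.
  rewrite leq_eqVlt => /orP[/eqP->|]; first by rewrite !subrr normr0.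
  rewrite ltnS => /IH {}IH; rewrite seriesSr addrAC.
  apply: le_trans (ler_normD _ _) _; apply: le_trans (lerD IH (aB m)) _.
  rewrite exprS invfM.
  lra.
have part' m : (n <= m)%N -> `|series a m - series a n| <= 2 * B / 2 ^+ n.
  move=> /part/le_trans; apply; rewrite lerBlDr lerDl.
  by rewrite divr_ge0 ?exprn_ge0// mulr_ge0.
have cva : cvgn (series a).
  apply: normed_cvg; apply: (@series_le_cvg _ _ (geometric B 2^-1)) => //.
  - by move=> k; rewrite normr_ge0.
  - by move=> k; rewrite /= mulr_ge0// exprn_ge0.
  - by move=> k; rewrite /= exprVn; exact: aB.
  - by apply: is_cvg_geometric_series; rewrite ger0_norm; lra.
have cvd : `|series a m - series a n| @[m --> \oo] --> `|limn (series a) - series a n|.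
  by apply: cvg_norm; apply: cvgB => //; exact: cvg_cst.
rewrite -(cvg_lim (@Rhausdorff R) cvd); apply: limr_le; first by apply/cvg_ex; eexists; exact: cvd.
by exists n => // m /= nm; exact: part'.
Qed.

(** Meaningful for sequences dominated by a geometric one of ratio 1/2. *)
Definition csum u : R[i] :=
  limn (series (fun k => complex.Re (u k))) +i* limn (series (fun k => complex.Im (u k))).

Definition psum u n := \sum_(k < n) u k.

Lemma psum_Re u n : complex.Re (psum u n) = series (fun k => complex.Re (u k)) n.
Proof.
rewrite /psum /series /= big_mkord; elim/big_rec2: _ => // i a b _ <-.
by case: (u i) b => ? ? [].
Qed.

Lemma psum_Im u n : complex.Im (psum u n) = series (fun k => complex.Im (u k)) n.
Proof.
rewrite /psum /series /= big_mkord; elim/big_rec2: _ => // i a b _ <-.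
by case: (u i) b => ? ? [].
Qed.

Lemma csum_tail u B : (forall n, cabs (u n) <= B / 2 ^+ n) ->
  forall n, cabs (csum u - psum u n) <= 4 * B / 2 ^+ n.
Proof.
move=> uB n; apply: le_trans (cabs_ReIm _) _.
have -> : 4 * B / 2 ^+ n = 2 * B / 2 ^+ n + 2 * B / 2 ^+ n by lra.
apply: lerD.
- have -> : complex.Re (csum u - psum u n) =
    limn (series (fun k => complex.Re (u k))) - series (fun k => complex.Re (u k)) n.
    by rewrite -psum_Re /csum; case: psum.
  by apply: rsum_tail => k /=; apply: le_trans (Re_cabs _) (uB k).
- have -> : complex.Im (csum u - psum u n) =
    limn (series (fun k => complex.Im (u k))) - series (fun k => complex.Im (u k)) n.
    by rewrite -psum_Im /csum; case: psum.
  by apply: rsum_tail => k /=; apply: le_trans (Im_cabs _) (uB k).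
Qed.

Lemma csum_le u B : (forall n, cabs (u n) <= B / 2 ^+ n) -> cabs (csum u) <= 4 * B.
Proof.
by move=> /csum_tail/(_ 0%N); rewrite /psum big_ord0 subr0 expr0 divr1.
Qed.

(** The tail bound of [csum_tail] characterizes the sum, which reduces identities
    between sums to identities between partial sums. *)
Lemma csum_unique u l B B' : (forall n, cabs (u n) <= B / 2 ^+ n) ->
  (forall n, cabs (l - psum u n.+1) <= B' / 2 ^+ n) -> csum u = l.
Proof.
move=> uB lB; apply/eqP; rewrite -subr_eq0 -cabs_eq0 eq_le cabs_ge0 andbT.
apply: (@le0_of_half_pow (4 * B + B')) => n.
have -> : csum u - l = (csum u - psum u n.+1) - (l - psum u n.+1) by ring.
apply: le_trans (cabsD _ _) _; rewrite cabsN mulrDl lerD//.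
apply: le_trans (csum_tail uB n.+1) _.
rewrite exprS invfM mulrA ler_pM2r ?invr_gt0 ?exprn_gt0//.
have := uB 0%N; rewrite expr0 divr1 => /(le_trans (cabs_ge0 _)); lra.
Qed.

Lemma csumD u v B B' : (forall n, cabs (u n) <= B / 2 ^+ n) ->
  (forall n, cabs (v n) <= B' / 2 ^+ n) ->
  csum (fun n => u n + v n) = csum u + csum v.
Proof.
move=> uB vB; apply: (@csum_unique _ _ (B + B') (4 * B + 4 * B')) => n.
  by apply: le_trans (cabsD _ _) _; rewrite mulrDl lerD.
have B0 : 0 <= B by have := uB 0%N; rewrite expr0 divr1; apply: le_trans (cabs_ge0 _).
have B'0 : 0 <= B' by have := vB 0%N; rewrite expr0 divr1; apply: le_trans (cabs_ge0 _).
have -> : csum u + csum v - psum (fun n => u n + v n) n.+1 =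
    (csum u - psum u n.+1) + (csum v - psum v n.+1).
  by rewrite /psum big_split /=; ring.
apply: le_trans (cabsD _ _) _; rewrite mulrDl.
have hp : 0 < 2^-1 ^+ n :> R by rewrite exprn_gt0.
apply: lerD; [apply: le_trans (csum_tail uB n.+1) _|apply: le_trans (csum_tail vB n.+1) _];
  by rewrite exprS invfM -exprVn; nra.
Qed.

Lemma csumZ a u B : (forall n, cabs (u n) <= B / 2 ^+ n) ->
  csum (fun n => a * u n) = a * csum u.
Proof.
move=> uB; have a0 := cabs_ge0 a.
have B0 : 0 <= B by have := uB 0%N; rewrite expr0 divr1; apply: le_trans (cabs_ge0 _).
apply: (@csum_unique _ _ (cabs a * B) (cabs a * (4 * B))) => n.
  by rewrite cabsM -mulrA ler_wpM2l.
rewrite /psum -mulr_sumr -mulrBr cabsM -mulrA ler_wpM2l//.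
apply: le_trans (csum_tail uB n.+1) _.
have hp : 0 < 2^-1 ^+ n :> R by rewrite exprn_gt0.
by rewrite exprS invfM -exprVn; nra.
Qed.

(** On the coefficients of a power series, multiplication by the variable. *)
Definition shift1 u n := if n is m.+1 then u m else 0.

Lemma csum_shift u B : (forall n, cabs (u n) <= B / 2 ^+ n) -> csum (shift1 u) = csum u.
Proof.
move=> uB.
have B0 : 0 <= B by have := uB 0%N; rewrite expr0 divr1; apply: le_trans (cabs_ge0 _).
apply: (@csum_unique _ _ (2 * B) (4 * B)) => [[|n]|n] /=.
- by rewrite cabs0 divr_ge0 ?exprn_ge0// mulr_ge0.
- apply: le_trans (uB n) _; rewrite exprS invfM.
  have hp : 0 < 2^-1 ^+ n :> R by rewrite exprn_gt0.
  by rewrite -exprVn; nra.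
- by rewrite /psum big_ord_recl /= add0r; exact: csum_tail.
Qed.

(** Uniformity in the index is what makes the sums pass to the limit along a
    filter on the indices. *)
Definition uniformly_entire (I : Type) (c : I -> nat -> R[i]) :=
  forall r, 0 < r -> exists2 B, 0 <= B & forall i n, cabs (c i n) * r ^+ n <= B.

Definition entire c := uniformly_entire (fun _ : unit => c).

Definition pser c z := csum (fun n => c n * z ^+ n).

Lemma uniformly_entire_geom (I : Type) (c : I -> nat -> R[i]) z : uniformly_entire c ->
  exists2 B, 0 <= B & forall i n, cabs (c i n * z ^+ n) <= B / 2 ^+ n.
Proof.
move=> ec; have z0 := cabs_ge0 z.
have [|B B0 H] := ec (2 * (cabs z + 1)); first by lra.
exists B => // i n; rewrite ler_pdivlMr ?exprn_gt0//; apply: le_trans (H i n).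
rewrite cabsM cabsX -mulrA ler_wpM2l ?cabs_ge0// mulrC exprMn ler_wpM2l ?exprn_ge0//.
by rewrite lerXn2r ?nnegrE//; lra.
Qed.

Lemma entire_geom c z : entire c -> exists B, forall n, cabs (c n * z ^+ n) <= B / 2 ^+ n.
Proof. by move=> /(uniformly_entire_geom z)[B _ H]; exists B => n; exact: (H tt). Qed.

Lemma pserD c d z : entire c -> entire d ->
  pser (fun n => c n + d n) z = pser c z + pser d z.
Proof.
move=> /(entire_geom z)[B cB] /(entire_geom z)[B' dB].
rewrite /pser -(csumD cB dB); congr csum; apply/funext => n; ring.
Qed.

Lemma pserZ a c z : entire c -> pser (fun n => a * c n) z = a * pser c z.
Proof.
move=> /(entire_geom z)[B cB].
rewrite /pser -(csumZ a cB); congr csum; apply/funext => n; ring.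
Qed.

Lemma pser_shift c z : entire c -> pser (shift1 c) z = z * pser c z.
Proof.
move=> /(entire_geom z)[B cB]; rewrite /pser -(csumZ z cB).
rewrite -[RHS](@csum_shift _ (cabs z * B)) => [|n].
  congr csum; apply/funext => -[|n]; rewrite /shift1.
    by rewrite mul0r.
  by rewrite exprS; ring.
by rewrite cabsM -mulrA ler_wpM2l ?cabs_ge0.
Qed.

Lemma entire_shift c : entire c -> entire (shift1 c).
Proof.
move=> ec r r0; have [B B0 H] := ec r r0.
exists (r * B) => [|_ [|n]] /=; first by rewrite mulr_ge0// ltW.
  by rewrite cabs0 mul0r mulr_ge0// ltW.
by rewrite exprS mulrCA ler_wpM2l ?(H tt)// ltW.
Qed.

Lemma entireD c d : entire c -> entire d -> entire (fun n => c n + d n).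
Proof.
move=> ec ed r r0; have [B B0 H] := ec r r0; have [B' B'0 H'] := ed r r0.
exists (B + B') => [|_ n]; first by rewrite addr_ge0.
apply: le_trans (lerD (H tt n) (H' tt n)).
by rewrite -mulrDl ler_wpM2r ?cabsD// exprn_ge0// ltW.
Qed.

Lemma entireZ a c : entire c -> entire (fun n => a * c n).
Proof.
move=> ec r r0; have [B B0 H] := ec r r0; exists (cabs a * B) => [|_ n].
  by rewrite mulr_ge0// cabs_ge0.
by rewrite cabsM -mulrA ler_wpM2l ?(H tt)// cabs_ge0.
Qed.

Definition pderiv c n := n.+1%:R * c n.+1.

Lemma uniformly_entire_pderiv (I : Type) (c : I -> nat -> R[i]) :
  uniformly_entire c -> uniformly_entire (fun i => pderiv (c i)).
Proof.
move=> ec r r0; have [|B B0 H] := ec (2 * r); first by lra.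
exists (B / r) => [|i n]; first by rewrite divr_ge0// ltW.
rewrite /pderiv cabsM cabs_nat ler_pdivlMr// -!mulrA -exprSr.
apply: le_trans (H i n.+1); rewrite exprMn mulrCA ler_wpM2l ?cabs_ge0//.
by rewrite ler_wpM2r ?exprn_ge0 ?(ltW r0)// -natrX ler_nat ltnW// ltn_expl.
Qed.

Lemma entire_pderiv c : entire c -> entire (pderiv c).
Proof. exact: uniformly_entire_pderiv. Qed.

Lemma power_remainder z h (rho : R) n : 1 <= rho -> cabs z <= rho -> cabs (z + h) <= rho ->
  cabs ((z + h) ^+ n - z ^+ n - h * (n%:R * z ^+ n.-1)) <= n%:R ^+ 2 * rho ^+ n * cabs h ^+ 2.
Proof.
move=> r1 zr zhr; have r0 : 0 <= rho by lra.
have zpow k : cabs (z ^+ k) <= rho ^+ k by rewrite cabsX lerXn2r ?nnegrE ?cabs_ge0.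
elim: n => [|n IH]; first by rewrite !expr0 mul0r mulr0 subrr subr0 cabs0 expr0n /= !mul0r.
have -> : (z + h) ^+ n.+1 - z ^+ n.+1 - h * (n.+1%:R * z ^+ n.+1.-1) =
  (z + h) * ((z + h) ^+ n - z ^+ n - h * (n%:R * z ^+ n.-1)) + n%:R * z ^+ n.-1 * h ^+ 2.
  by case: n {IH} => [|n] /=; rewrite ?expr0 ?expr1 !exprS -?natr1; ring.
apply: le_trans (cabsD _ _) _; rewrite !cabsM cabs_nat -[cabs h * cabs h]expr2.
have IH' : cabs (z + h) * cabs ((z + h) ^+ n - z ^+ n - h * (n%:R * z ^+ n.-1)) <=
    rho * (n%:R ^+ 2 * rho ^+ n * cabs h ^+ 2).
  by apply: ler_pM; rewrite ?cabs_ge0.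
have zp : cabs (z ^+ n.-1) <= rho ^+ n.+1.
  by apply: le_trans (zpow _) _; apply: ler_weXn2l => //; case: n {IH IH'} => // n; rewrite 2?leqW.
have hh : 0 <= cabs h ^+ 2 by rewrite exprn_ge0 ?cabs_ge0.
apply: le_trans (lerD IH' (ler_wpM2r hh (ler_wpM2l (ler0n _ n) zp))) _.
have -> : rho * (n%:R ^+ 2 * rho ^+ n * cabs h ^+ 2) + n%:R * rho ^+ n.+1 * cabs h ^+ 2
  = (n%:R ^+ 2 + n%:R) * (rho ^+ n.+1 * cabs h ^+ 2) by rewrite [rho ^+ n.+1]exprS; ring.
rewrite -[leRHS]mulrA ler_wpM2r ?mulr_ge0 ?exprn_ge0 ?cabs_ge0//.
by rewrite -natr1; have := ler0n R n; nra.
Qed.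

Lemma pser_cderiv c : entire c -> cderiv (pser c) (pser (pderiv c)).
Proof.
move=> ec z; have z0 := cabs_ge0 z.
pose rho := cabs z + 1.
have [|B B0 H] := ec (8 * rho); first by rewrite /rho; lra.
exists (4 * B) => [|h h1]; first by lra.
have bound n : cabs (c n * ((z + h) ^+ n - z ^+ n - h * (n%:R * z ^+ n.-1)))
    <= B * cabs h ^+ 2 / 2 ^+ n.
  rewrite cabsM ler_pdivlMr ?exprn_gt0//.
  have rem : cabs ((z + h) ^+ n - z ^+ n - h * (n%:R * z ^+ n.-1)) <=
      4 ^+ n * rho ^+ n * cabs h ^+ 2.
    apply: le_trans (@power_remainder z h rho n _ _ _) _; rewrite /rho; try lra.
      by apply: le_trans (cabsD _ _) _; lra.
    rewrite ler_wpM2r ?exprn_ge0 ?cabs_ge0// ler_wpM2r ?exprn_ge0//; first by lra.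
    have -> : 4 = 2 ^+ 2 :> R by lra.
    by rewrite exprAC lerXn2r ?nnegrE ?exprn_ge0// -natrX ler_nat ltnW// ltn_expl.
  have c0 := cabs_ge0 (c n).
  apply: le_trans (ler_wpM2r (exprn_ge0 n _) (ler_wpM2l c0 rem)) _ => //.
  apply: le_trans (ler_wpM2r (exprn_ge0 2 (cabs_ge0 h)) (H tt n)).
  rewrite -(_ : 4 * 2 = 8 :> R); last by lra.
  by rewrite !exprMn le_eqVlt; apply/orP; left; apply/eqP; ring.
have [Bz zB] := entire_geom z ec.
have [Bw wB] := entire_geom (z + h) ec.
have [Bd dB] := entire_geom z (entire_pderiv ec).
have -> : pser c (z + h) - pser c z - h * pser (pderiv c) z =
    csum (fun n => c n * ((z + h) ^+ n - z ^+ n - h * (n%:R * z ^+ n.-1))).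
  have hdB n : cabs (- h * (pderiv c n * z ^+ n)) <= (cabs h * Bd) / 2 ^+ n.
    by rewrite cabsM cabsN -mulrA ler_wpM2l ?cabs_ge0.
  have Bd0 : 0 <= cabs h * Bd.
    by have := hdB 0%N; rewrite expr0 divr1; apply: le_trans (cabs_ge0 _).
  have hsB n : cabs (shift1 (fun n => - h * (pderiv c n * z ^+ n)) n) <= (2 * (cabs h * Bd)) / 2 ^+ n.
    case: n => [|n] /=; first by rewrite cabs0 divr_ge0 ?exprn_ge0// mulr_ge0.
    apply: le_trans (hdB n) _; rewrite exprS invfM.
    have hp : 0 < 2^-1 ^+ n :> R by rewrite exprn_gt0.
  by rewrite -exprVn; nra.
  have nzB n : cabs (-1 * (c n * z ^+ n)) <= Bz / 2 ^+ n by rewrite mulN1r cabsN.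
  rewrite -mulNr /pser -(csumZ (- h) dB) -(csum_shift hdB) -mulN1r -(csumZ (-1) zB).
  rewrite -(csumD wB nzB).
  have wzB n : cabs (c n * (z + h) ^+ n + -1 * (c n * z ^+ n)) <= (Bw + Bz) / 2 ^+ n.
    by apply: le_trans (cabsD _ _) _; rewrite mulrDl lerD.
  rewrite -(csumD wzB hsB); congr csum; apply/funext => -[|n] /=; rewrite /pderiv; ring.
by apply: le_trans (csum_le bound) _; rewrite mulrA.
Qed.

Definition ctends (I : Type) (F : set_system I) (u : I -> R[i]) l :=
  forall e : R, 0 < e -> \forall i \near F, cabs (u i - l) < e.

Section Limits.
Context (I : Type) (F : set_system I) {FF : Filter F}.

Lemma ctends_cst l : ctends F (fun=> l) l.
Proof. by move=> e e0; apply: nearW => i; rewrite subrr cabs0. Qed.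

Lemma ctendsD (f g : I -> R[i]) a b : ctends F f a -> ctends F g b ->
  ctends F (fun i => f i + g i) (a + b).
Proof.
move=> fa gb e e0; have e2 : 0 < e / 2 by lra.
apply: filterS2 (fa _ e2) (gb _ e2) => i fi gi.
have -> : f i + g i - (a + b) = (f i - a) + (g i - b) by ring.
by apply: le_lt_trans (cabsD _ _) _; lra.
Qed.

Lemma ctendsM (f g : I -> R[i]) a b : ctends F f a -> ctends F g b ->
  ctends F (fun i => f i * g i) (a * b).
Proof.
move=> fa gb e e0; have a0 := cabs_ge0 a; have b0 := cabs_ge0 b.
pose d := Num.min 1 (e / (cabs a + cabs b + 1)).
have d0 : 0 < d by rewrite lt_min ltr01 divr_gt0//; lra.
apply: filterS2 (fa _ d0) (gb _ d0) => i.
rewrite !lt_min => /andP[_ fi] /andP[g1 gi].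
have -> : f i * g i - a * b = (f i - a) * (g i - b) + (f i - a) * b + a * (g i - b) by ring.
apply: le_lt_trans (cabsD _ _) _; apply: le_lt_trans (lerD (cabsD _ _) (lexx _)) _.
rewrite !cabsM.
move: fi gi; rewrite !ltr_pdivlMr; [|lra|lra].
have := cabs_ge0 (f i - a); have := cabs_ge0 (g i - b).
move: (cabs (f i - a)) (cabs (g i - b)) g1 => x y; nra.
Qed.

Lemma ctends_sum (f : I -> nat -> R[i]) l n : (forall k, ctends F (f^~ k) (l k)) ->
  ctends F (fun i => psum (f i) n) (psum l n).
Proof.
move=> fl; elim: n => [|n IH].
  by rewrite /psum big_ord0; under eq_fun do rewrite big_ord0; exact: ctends_cst.
rewrite /psum big_ord_recr /=; under eq_fun do rewrite big_ord_recr /=.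
exact: ctendsD.
Qed.

(** Tannery's theorem: termwise convergence suffices under a uniform geometric
    majorant. *)
Lemma ctends_pser (c : I -> nat -> R[i]) l z : uniformly_entire c -> entire l ->
  (forall n, ctends F (c^~ n) (l n)) -> ctends F (fun i => pser (c i) z) (pser l z).
Proof.
move=> /(uniformly_entire_geom z)[B B0 cB] /(entire_geom z)[B' lB] cl e e0.
have [n nB] := half_pow_lt (4 * B + 4 * B') (divr_gt0 e0 (ltr0n _ 2)).
have cln k : ctends F (fun i => c i k * z ^+ k) (l k * z ^+ k).
  by apply: ctendsM => //; exact: ctends_cst.
have e2 : 0 < e / 2 by lra.
apply: filterS (ctends_sum n cln e2) => i.
set s := psum _ n; set t := psum _ n => st.
have -> : pser (c i) z - pser l z = (pser (c i) z - s) + (s - t) - (pser l z - t) by ring.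
apply: le_lt_trans (cabsD _ _) _; rewrite cabsN.
have h1 := csum_tail (cB i) n; have h2 := csum_tail lB n.
have h3 := cabsD (pser (c i) z - s) (s - t).
move: nB; rewrite mulrDl => nB.
rewrite -/(pser _ _) -/s in h1; rewrite -/(pser _ _) -/t in h2; lra.
Qed.

End Limits.
End PowerSeries.

(** * Solutions of the cubic equation *)

Section CubicEquation.
Context {R : realType}.
Implicit Types (e E r t : R) (a b z w d Om : R[i]) (n N : nat).

Definition cubic e E z : R[i] := e%:C * z ^+ 3 + z ^+ 2 + E%:C.

Definition Re_cubic e E (x t : R) : R :=
  e * (x ^+ 3 - 3 * x * t ^+ 2) + x ^+ 2 - t ^+ 2 + E.
Definition Im_cubic e (x t : R) : R := e * (3 * x ^+ 2 * t - t ^+ 3) + 2 * x * t.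

Lemma cubicE e E x t : cubic e E (x +i* t) = Re_cubic e E x t +i* Im_cubic e x t.
Proof.
rewrite /cubic !exprS expr0 /=.
by congr (_ +i* _); rewrite /Re_cubic /Im_cubic; ring.
Qed.

(** The Taylor coefficients at the origin of the solution with [y 0 = a] and
    [y' 0 = b]; the nested matches read as 0 the coefficients of negative index. *)
Fixpoint coef e E a b n : R[i] :=
  match n with
  | 0 => a
  | 1 => b
  | (m.+1 as m1).+1 =>
     (E%:C * coef e E a b m +
      (if m is (m2.+1).+1 then
         coef e E a b m2 + (if m2 is m3.+1 then e%:C * coef e E a b m3 else 0)
       else 0)) / (m1 * m.+2)%:R
  end.

Lemma coef_rec e E a b n : n.+1%:R * (n.+2%:R * coef e E a b n.+2) =
  E%:C * coef e E a b n +
  (shift1 (shift1 (coef e E a b)) n +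
   e%:C * shift1 (shift1 (shift1 (coef e E a b))) n).
Proof.
rewrite [coef e E a b n.+2]/=.
set X := (X in X / _); have -> : n.+1%:R * (n.+2%:R * (X / (n.+1 * n.+2)%:R)) = X.
  by rewrite mulrA -natrM mulrC divfK// pnatr_eq0.
by rewrite /X; case: n {X} => [|[|[|n]]]; rewrite /shift1 ?mulr0 ?addr0.
Qed.

(** In [c_n r^n] the recursion loses a factor [D = 5 r^5] per step but gains
    [1 / ((n + 1) (n + 2))]; so these numbers may grow by [D] while [n < n0],
    and no longer afterwards, uniformly in all the parameters. *)
Lemma uniformly_entire_coef (I : Type) (A : R) (e E : I -> R) (a b : I -> R[i]) :
  (forall i, `|e i| <= 2) -> (forall i, `|E i| <= 2) ->
  (forall i, cabs (a i) <= A) -> (forall i, cabs (b i) <= A) ->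
  uniformly_entire (fun i => coef (e i) (E i) (a i) (b i)).
Proof.
move=> e2 E2 aA bA r0' r0'0.
suff H r : 1 <= r -> exists2 B : R, 0 <= B &
    forall i n, cabs (coef (e i) (E i) (a i) (b i) n) * r ^+ n <= B.
  have [|B B0 HB] := H (r0' + 1); first by lra.
  exists B => // i n; apply: le_trans (HB i n).
  by rewrite ler_wpM2l ?cabs_ge0// lerXn2r ?nnegrE; lra.
move=> {r0' r0'0} r1; have r0 : 0 <= r by lra.
have [i0|noI] := pselect (inhabited I); last first.
  by exists 0 => // i; case: noI; exact: (inhabits i).
have A0 : 0 <= A by case: i0 => i; apply: le_trans (aA i); exact: cabs_ge0.
pose D := 5 * r ^+ 5.
have r5 : 1 <= r ^+ 5 by rewrite exprn_ege1.
have D1 : 1 <= D by rewrite /D; lra.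
have D0 : 0 <= D by lra.
pose n0 := (Num.truncn D).+1.
have Dn0 : D <= n0%:R by rewrite ltW// truncnS_gt.
exists (A * D ^+ n0) => [|i n]; first by rewrite mulr_ge0// exprn_ge0.
pose c := coef (e i) (E i) (a i) (b i).
have Dmono k l : (k <= l)%N -> A * D ^+ minn k n0 <= A * D ^+ minn l n0.
  move=> kl; rewrite ler_wpM2l//; apply: ler_weXn2l => //.
  by rewrite leq_min geq_minr geq_min kl.
suff {n} H n : cabs (c n) * r ^+ n <= A * D ^+ minn n n0.
  apply: le_trans (H n) _; rewrite ler_wpM2l//; apply: ler_weXn2l => //.
  exact: geq_minr.
have [n1] := ubnP n; elim: n1 n => // n1 IH [|[|n]] nn1.
- by rewrite min0n !expr0 !mulr1; exact: aA.
- rewrite expr1 /n0 minnSS min0n expr1; apply: ler_pM => //; rewrite ?cabs_ge0//; first exact: bA.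
  have : r <= r ^+ 5 by rewrite -[leLHS]expr1; apply: ler_weXn2l.
  by rewrite /D; lra.
set M := A * D ^+ minn n n0.
have M0 : 0 <= M by rewrite mulr_ge0// exprn_ge0.
have low k j : (k <= n)%N -> (n.+2 = k + j)%N -> (j <= 5)%N ->
    cabs (c k) * r ^+ n.+2 <= M * r ^+ 5.
  move=> kn -> j5; rewrite exprD mulrA; apply: ler_pM; rewrite ?mulr_ge0 ?exprn_ge0 ?cabs_ge0//.
    by apply: le_trans (IH k _) (Dmono _ _ kn); rewrite (leq_ltn_trans kn)// -ltnS ltnW.
  exact: ler_weXn2l.
have Mr0 : 0 <= M * r ^+ 5 by rewrite mulr_ge0// exprn_ge0.
have low1 : cabs (c n) * r ^+ n.+2 <= M * r ^+ 5 by apply: (low n 2) => //; rewrite addn2.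
have low2 : cabs (shift1 (shift1 c) n) * r ^+ n.+2 <= M * r ^+ 5.
  case: n @M M0 low Mr0 {IH nn1 low1} => [|[|n]] M M0 low Mr0 /=; rewrite ?cabs0 ?mul0r//.
  by apply: (low n 4%N) => //; rewrite ?addn4// ltnW.
have low3 : cabs (shift1 (shift1 (shift1 c)) n) * r ^+ n.+2 <= M * r ^+ 5.
  case: n @M M0 low Mr0 {IH nn1 low1 low2} => [|[|[|n]]] M M0 low Mr0 /=; rewrite ?cabs0 ?mul0r//.
  by apply: (low n 5%N) => //; rewrite ?addnS ?addn0// ltnW// ltnW.
have step : n.+1%:R * (n.+2%:R * (cabs (c n.+2) * r ^+ n.+2)) <= D * M.
  have -> : n.+1%:R * (n.+2%:R * (cabs (c n.+2) * r ^+ n.+2)) =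
      cabs (n.+1%:R * (n.+2%:R * c n.+2)) * r ^+ n.+2.
    by rewrite !cabsM !cabs_nat !mulrA.
  rewrite coef_rec -/c.
  apply: le_trans (ler_wpM2r (exprn_ge0 _ r0) (cabsD _ _)) _.
  have := cabsD (shift1 (shift1 c) n) ((e i)%:C * shift1 (shift1 (shift1 c)) n).
  move=> /(ler_wpM2r (exprn_ge0 n.+2 r0)).
  rewrite !mulrDl !cabsMr.
  have := ler_wpM2l (normr_ge0 (E i)) low1; have := ler_wpM2l (normr_ge0 (e i)) low3.
  have := ler_wpM2r Mr0 (E2 i); have := ler_wpM2r Mr0 (e2 i).
  have -> : D * M = 5 * (M * r ^+ 5) by rewrite /D; ring.
  lra.
have X0 : 0 <= cabs (c n.+2) * r ^+ n.+2 by rewrite mulr_ge0 ?cabs_ge0// exprn_ge0.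
have [nn0|nn0] := leqP n.+2 n0.
- apply: le_trans (_ : D * M <= _); last first.
    rewrite /M mulrCA -exprS ler_wpM2l//; apply: ler_weXn2l => //.
    by rewrite ltnS (leq_trans (geq_minl _ _)).
  apply: le_trans step; rewrite mulrA ler_peMl// -natrM ler1n muln_gt0.
  by [].
- apply: le_trans (_ : M <= _); last first.
    by rewrite /M ler_wpM2l//; apply: ler_weXn2l => //; exact: geq_minr.
  have Dp : 0 < D by lra.
  rewrite -(ler_pM2l Dp); apply: le_trans step.
  rewrite mulrA ler_wpM2r//; apply: le_trans Dn0 _.
  by rewrite -natrM ler_nat (leq_trans _ (leq_pmulr _ _)).
Qed.

Definition sol e E a b := pser (coef e E a b).
Definition sol' e E a b := pser (pderiv (coef e E a b)).

Lemma entire_coef e E a b : `|e| <= 2 -> `|E| <= 2 -> entire (coef e E a b).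
Proof.
move=> e2 E2; apply: (@uniformly_entire_coef unit (cabs a + cabs b)
  (fun=> e) (fun=> E) (fun=> a) (fun=> b)) => //= _;
  by rewrite ?lerDl ?lerDr cabs_ge0.
Qed.

Lemma sol_cderiv e E a b : `|e| <= 2 -> `|E| <= 2 -> cderiv (sol e E a b) (sol' e E a b).
Proof. by move=> e2 E2; apply: pser_cderiv; exact: entire_coef. Qed.

Lemma sol'_cderiv e E a b : `|e| <= 2 -> `|E| <= 2 ->
  cderiv (sol' e E a b) (fun z => cubic e E z * sol e E a b z).
Proof.
move=> e2 E2; have ec := entire_coef a b e2 E2.
have es2 := entire_shift (entire_shift ec).
have es3 := entire_shift es2.
have -> : (fun z => cubic e E z * sol e E a b z) = pser (pderiv (pderiv (coef e E a b))).
  apply/funext => z.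
  rewrite [pderiv (pderiv _)](_ : _ = fun n => E%:C * coef e E a b n +
     (shift1 (shift1 (coef e E a b)) n +
      e%:C * shift1 (shift1 (shift1 (coef e E a b))) n)); last first.
    by apply/funext => n; exact: coef_rec.
  rewrite pserD ?pserZ ?pserD ?pserZ ?pser_shift//; do ?[exact: entire_shift];
    do ?[exact: entireZ]; do ?[by apply: entireD => //; exact: entireZ].
  by rewrite /cubic /sol; ring.
by apply: pser_cderiv; exact: entire_pderiv.
Qed.

Lemma pser0 (c : nat -> R[i]) : entire c -> pser c 0 = c 0%N.
Proof.
move=> /(entire_geom 0)[B cB]; apply: (csum_unique (B' := 0) cB) => n.
rewrite /psum big_ord_recl /= expr0 mulr1 big1 => [|i _].
  by rewrite addr0 subrr cabs0 mul0r.
by rewrite expr0n /= mulr0.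
Qed.

Lemma sol0 e E a b : `|e| <= 2 -> `|E| <= 2 -> sol e E a b 0 = a.
Proof. by move=> e2 E2; rewrite /sol pser0//; exact: entire_coef. Qed.

Lemma sol'0 e E a b : `|e| <= 2 -> `|E| <= 2 -> sol' e E a b 0 = b.
Proof.
by move=> e2 E2; rewrite /sol' pser0 /pderiv ?mul1r//; apply: entire_pderiv; exact: entire_coef.
Qed.

Lemma coef_lin e E a b n :
  coef e E a b n = a * coef e E 1 0 n + b * coef e E 0 1 n.
Proof.
have [n1] := ubnP n; elim: n1 n => // n1 IH [|[|n]] nn1; rewrite /= ?mulr0 ?mulr1 ?addr0 ?add0r//.
have {}IH k : (k <= n)%N -> coef e E a b k = a * coef e E 1 0 k + b * coef e E 0 1 k.
  by move=> kn; apply: IH; rewrite -ltnS (leq_trans _ nn1)// !ltnS leqW.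
rewrite IH//; case: n {nn1} IH => [|[|[|n]]] IH; rewrite ?addr0; do ?[by ring].
  by rewrite (IH 0%N)//; ring.
have n1n3 : (n.+1 <= n.+3)%N by rewrite ltnS !leqW.
have nn3 : (n <= n.+3)%N by rewrite !leqW.
rewrite (IH _ n1n3) (IH _ nn3) 2!mulrA -mulrDl; congr (_ / _); ring.
Qed.

Lemma sol_lin e E a b z : `|e| <= 2 -> `|E| <= 2 ->
  sol e E a b z = a * sol e E 1 0 z + b * sol e E 0 1 z.
Proof.
move=> e2 E2; have ec u v := entire_coef u v e2 E2.
rewrite /sol (funext (coef_lin e E a b)).
by rewrite (pserD _ (entireZ a (ec 1 0)) (entireZ b (ec 0 1))) !(pserZ _ _ (ec _ _)).
Qed.

Lemma sol'_lin e E a b z : `|e| <= 2 -> `|E| <= 2 ->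
  sol' e E a b z = a * sol' e E 1 0 z + b * sol' e E 0 1 z.
Proof.
move=> e2 E2; have ec u v := entire_pderiv (entire_coef u v e2 E2).
rewrite /sol' (_ : pderiv (coef e E a b) =
    fun n => a * pderiv (coef e E 1 0) n + b * pderiv (coef e E 0 1) n); last first.
  apply/funext => n; rewrite [pderiv _ n]/pderiv coef_lin /pderiv.
  by move: (coef e E 1 0 _) (coef e E 0 1 _) => u v; ring.
by rewrite (pserD _ (entireZ a (ec 1 0)) (entireZ b (ec 0 1))) !(pserZ _ _ (ec _ _)).
Qed.

Lemma conj_pser (c : nat -> R[i]) z : entire c -> (forall n, (c n)^* = c n) ->
  (pser c z)^* = pser c z^*.
Proof.
move=> ec cr; have [B zB] := entire_geom z ec; have [B' zB'] := entire_geom z^* ec.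
apply/esym/(csum_unique (B' := 4 * B) zB') => n.
have -> : psum (fun n => c n * z^* ^+ n) n.+1 = (psum (fun n => c n * z ^+ n) n.+1)^*.
  by rewrite /psum rmorph_sum; apply: eq_bigr => k _; rewrite rmorphM rmorphXn /= cr.
rewrite -rmorphB cabs_conj; apply: le_trans (csum_tail zB n.+1) _.
have hp : 0 < 2^-1 ^+ n :> R by rewrite exprn_gt0.
have : 0 <= B by have := zB 0%N; rewrite [2 ^+ 0]expr0 divr1; apply: le_trans (cabs_ge0 _).
by rewrite exprS invfM -exprVn; nra.
Qed.

Lemma coef_real e E (a b : R) n : (coef e E a%:C b%:C n)^* = coef e E a%:C b%:C n.
Proof.
have [n1] := ubnP n; elim: n1 n => // n1 IH [|[|n]] nn1.
- by rewrite /= oppr0.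
- by rewrite /= oppr0.
have {}IH k : (k <= n)%N -> (coef e E a%:C b%:C k)^* = coef e E a%:C b%:C k.
  by move=> kn; apply: IH; rewrite -ltnS (leq_trans _ nn1)// !ltnS leqW.
have cC (t : R) : (t%:C)^* = t%:C := conjc_real t.
have c0 : (0 : R[i])^* = 0 := conjc0 R.
have cM (x y : R[i]) : (x * y)^* = x^* * y^* by rewrite rmorphM.
have cD (x y : R[i]) : (x + y)^* = x^* + y^* by rewrite rmorphD.
have cV (k : nat) : ((k%:R : R[i])^-1)^* = k%:R^-1 by rewrite fmorphV rmorph_nat.
rewrite [coef _ _ _ _ n.+2]/= cM cV cD cM cC IH//.
case: n {nn1} IH => [|[|[|n]]] IH; rewrite ?c0// cD ?c0 ?cM ?cC ?(IH 0%N)//.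
have n1n3 : (n.+1 <= n.+3)%N by rewrite ltnS !leqW.
have nn3 : (n <= n.+3)%N by rewrite !leqW.
by rewrite (IH _ n1n3) (IH _ nn3).
Qed.

Lemma sol_conj e E (a b : R) z : `|e| <= 2 -> `|E| <= 2 ->
  sol e E a%:C b%:C z^* = (sol e E a%:C b%:C z)^*.
Proof.
by move=> e2 E2; apply/esym/conj_pser; [exact: entire_coef|exact: coef_real].
Qed.

Lemma sol'_conj e E (a b : R) z : `|e| <= 2 -> `|E| <= 2 ->
  sol' e E a%:C b%:C z^* = (sol' e E a%:C b%:C z)^*.
Proof.
move=> e2 E2; apply/esym/conj_pser; first exact/entire_pderiv/entire_coef.
by move=> n; rewrite /pderiv rmorphM rmorph_nat; congr (_ * _); exact: coef_real.
Qed.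

Section Continuity.
Context (I : Type) (F : set_system I) {FF : Filter F}.
Variables (e E : I -> R) (a b : I -> R[i]) (e0 E0 : R) (a0 b0 : R[i]) (A : R).
Hypotheses (e2 : forall i, `|e i| <= 2) (E2 : forall i, `|E i| <= 2).
Hypotheses (aA : forall i, cabs (a i) <= A) (bA : forall i, cabs (b i) <= A).
Hypotheses (e02 : `|e0| <= 2) (E02 : `|E0| <= 2).
Hypotheses (eF : ctends F (fun i => (e i)%:C) e0%:C) (EF : ctends F (fun i => (E i)%:C) E0%:C).
Hypotheses (aF : ctends F a a0) (bF : ctends F b b0).

Lemma ctends_coef n : ctends F (fun i => coef (e i) (E i) (a i) (b i) n) (coef e0 E0 a0 b0 n).
Proof.
have [n1] := ubnP n; elim: n1 n => // n1 IH [|[|n]] nn1 //.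
have {}IH k : (k <= n)%N -> ctends F (fun i => coef (e i) (E i) (a i) (b i) k) (coef e0 E0 a0 b0 k).
  by move=> kn; apply: IH; rewrite -ltnS (leq_trans _ nn1)// !ltnS leqW.
apply: (ctendsM _ (ctends_cst _)); apply: ctendsD; first by apply: ctendsM => //; exact: IH.
case: n {nn1} IH => [|[|n]] IH; [exact: ctends_cst..|].
apply: ctendsD; first by apply: IH; rewrite !leqW.
case: n IH => [|n] IH; first exact: ctends_cst.
by apply: ctendsM => //; apply: IH; rewrite !leqW.
Qed.

Lemma ctends_sol z : ctends F (fun i => sol (e i) (E i) (a i) (b i) z) (sol e0 E0 a0 b0 z).
Proof.
apply: ctends_pser ctends_coef; first exact: uniformly_entire_coef aA bA.
exact: entire_coef.
Qed.

Lemma ctends_sol' z : ctends F (fun i => sol' (e i) (E i) (a i) (b i) z) (sol' e0 E0 a0 b0 z).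
Proof.
apply: ctends_pser.
- by apply: uniformly_entire_pderiv; exact: uniformly_entire_coef aA bA.
- by apply: entire_pderiv; exact: entire_coef.
- by move=> n; apply: ctendsM; [exact: ctends_cst|exact: ctends_coef].
Qed.

End Continuity.
End CubicEquation.

Opaque sol sol'.

(** * Flux and Wronskian *)

Section Flux.
Context {R : realType}.
Implicit Types (z d Om w : R[i]) (Q y u : R[i] -> R[i]).

Definition ode Q y (y1 : R[i] -> R[i]) := cderiv y y1 /\ cderiv y1 (fun z => Q z * y z).

(** For [Om = d] this is half the derivative of [|y|^2] in the direction [d];
    other multipliers [Om] rotate it. *)
Definition flux y (y1 : R[i] -> R[i]) Om z : R := complex.Re (Om * (y1 z * (y z)^*)).

Lemma flux_derive Q y y1 Om z d (r : R) : ode Q y y1 ->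
  is_derive r 1 (fun r => flux y y1 Om (z + r%:C * d))
   (complex.Re (Om * d^*) * cabs (y1 (z + r%:C * d)) ^+ 2 +
    complex.Re (Om * d * Q (z + r%:C * d)) * cabs (y (z + r%:C * d)) ^+ 2).
Proof.
move=> [yd y1d].
have [f1d f2d] := is_derive_line z d r yd.
have [g1d g2d] := is_derive_line z d r y1d.
have -> : (fun r => flux y y1 Om (z + r%:C * d)) = (fun r : R =>
   complex.Re Om * (complex.Re (y1 (z + r%:C * d)) * complex.Re (y (z + r%:C * d)) +
      complex.Im (y1 (z + r%:C * d)) * complex.Im (y (z + r%:C * d))) -
   complex.Im Om * (complex.Im (y1 (z + r%:C * d)) * complex.Re (y (z + r%:C * d)) -
      complex.Re (y1 (z + r%:C * d)) * complex.Im (y (z + r%:C * d)))).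
  apply/funext => s; rewrite /flux; case: Om (y1 _) (y _) => [? ?] [? ?] [? ?] /=; ring.
apply: is_derive_eq; rewrite !cabs_sqr.
set p := z + _; move: (y p) (y1 p) (Q p); clear - Om d.
case: Om d => [? ?] [? ?] [? ?] [? ?] [? ?].
by rewrite /GRing.scale /=; ring.
Qed.

Section Monotone.
Context (Q : R[i] -> R[i]) (y y1 : R[i] -> R[i]) (yS : ode Q y y1) (Om z d : R[i]).
Hypotheses (Omd : 0 <= complex.Re (Om * d^*))
  (OmdQ : forall r : R, 0 <= r -> r <= 1 -> 0 <= complex.Re (Om * d * Q (z + r%:C * d))).

Lemma flux_le : flux y y1 Om z <= flux y y1 Om (z + d).
Proof.
have := is_derive_nondecreasing ler01 (fun r _ _ => flux_derive Om z d r yS).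
rewrite rmorph0 mul0r addr0 rmorph1 mul1r; apply => r r0 r1.
by apply: addr_ge0; apply: mulr_ge0; rewrite ?exprn_ge0 ?cabs_ge0// OmdQ.
Qed.

Lemma flux_lt :
  0 < complex.Re (Om * d^*) * cabs (y1 z) ^+ 2 + complex.Re (Om * d * Q z) * cabs (y z) ^+ 2 ->
  flux y y1 Om z < flux y y1 Om (z + d).
Proof.
move=> d0.
have := is_derive_increasing ltr01 (fun r _ _ => flux_derive Om z d r yS).
rewrite rmorph0 mul0r addr0 rmorph1 mul1r; apply => // r r0 r1.
by apply: addr_ge0; apply: mulr_ge0; rewrite ?exprn_ge0 ?cabs_ge0// OmdQ.
Qed.

End Monotone.

Lemma flux0 y y1 Om z : y z = 0 -> flux y y1 Om z = 0.
Proof. by rewrite /flux => ->; rewrite /= oppr0; case: Om (y1 z) => ? ? [? ?] /=; ring. Qed.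

Lemma wronskian_cst Q y y1 u u1 z w : ode Q y y1 -> ode Q u u1 ->
  y z * u1 z - y1 z * u z = y w * u1 w - y1 w * u w.
Proof.
move=> [yd y1d] [ud u1d]; pose d := z - w.
pose W := fun r : R => y (w + r%:C * d) * u1 (w + r%:C * d) - y1 (w + r%:C * d) * u (w + r%:C * d).
suff : W 1 = W 0 by rewrite /W rmorph1 rmorph0 mul1r mul0r addr0 /d addrCA subrr addr0.
have eqW (a b : R[i]) : complex.Re a = complex.Re b -> complex.Im a = complex.Im b -> a = b.
  by case: a b => ? ? [? ?] /= -> ->.
have dl (r : R) := (is_derive_line w d r yd, is_derive_line w d r y1d,
  is_derive_line w d r ud, is_derive_line w d r u1d).
apply: eqW.
- apply: (@is_derive0_cst _ (fun r => complex.Re (W r))) => r.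
  have [[[[? ?] [? ?]] [? ?]] [? ?]] := dl r.
  have -> : (fun r => complex.Re (W r)) = (fun r : R =>
     complex.Re (y (w + r%:C * d)) * complex.Re (u1 (w + r%:C * d)) -
     complex.Im (y (w + r%:C * d)) * complex.Im (u1 (w + r%:C * d)) -
     (complex.Re (y1 (w + r%:C * d)) * complex.Re (u (w + r%:C * d)) -
     complex.Im (y1 (w + r%:C * d)) * complex.Im (u (w + r%:C * d)))).
    by apply/funext => s; rewrite /W; case: (y _) (y1 _) (u _) (u1 _) => ? ? [? ?] [? ?] [? ?].
  apply: is_derive_eq.
  set p := w + _; move: (y p) (y1 p) (u p) (u1 p) (Q p); move: (d); clear.
  move=> [? ?] [? ?] [? ?] [? ?] [? ?] [? ?].
  by rewrite /GRing.scale /=; ring.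
- apply: (@is_derive0_cst _ (fun r => complex.Im (W r))) => r.
  have [[[[? ?] [? ?]] [? ?]] [? ?]] := dl r.
  have -> : (fun r => complex.Im (W r)) = (fun r : R =>
     complex.Re (y (w + r%:C * d)) * complex.Im (u1 (w + r%:C * d)) +
     complex.Im (y (w + r%:C * d)) * complex.Re (u1 (w + r%:C * d)) -
     (complex.Re (y1 (w + r%:C * d)) * complex.Im (u (w + r%:C * d)) +
     complex.Im (y1 (w + r%:C * d)) * complex.Re (u (w + r%:C * d)))).
    by apply/funext => s; rewrite /W; case: (y _) (y1 _) (u _) (u1 _) => ? ? [? ?] [? ?] [? ?].
  apply: is_derive_eq.
  set p := w + _; move: (y p) (y1 p) (u p) (u1 p) (Q p); move: (d); clear.
  move=> [? ?] [? ?] [? ?] [? ?] [? ?] [? ?].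
  by rewrite /GRing.scale /=; ring.
Qed.

(** At a zero of [y] the Wronskian of [y] and [u] is [- y' u]. *)
Lemma modulus_at_zeros Q y (y1 : R[i] -> R[i]) u u1 z w : ode Q y y1 -> ode Q u u1 ->
  y z = 0 -> y w = 0 -> y1 z != 0 -> cabs (y1 w) = cabs (y1 z) -> cabs (u z) = cabs (u w).
Proof.
move=> yS uS yz yw y1z e; have := wronskian_cst z w yS uS.
rewrite yz yw !mul0r !sub0r => /(congr1 cabs); rewrite !cabsN !cabsM e => /mulfI; apply.
by rewrite cabs_eq0.
Qed.

Section Sol.
Context (e E : R) (e2 : `|e| <= 2) (E2 : `|E| <= 2).

Lemma sol_ode a b : ode (cubic e E) (sol e E a b) (sol' e E a b).
Proof. by split; [exact: sol_cderiv|exact: sol'_cderiv]. Qed.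

Lemma sol_simple_zero a b z : (a, b) != (0, 0) -> sol e E a b z = 0 -> sol' e E a b z != 0.
Proof.
move=> ab0 yz; apply/eqP => y1z; case/eqP: ab0.
have := wronskian_cst 0 z (sol_ode a b) (sol_ode 1 0).
have := wronskian_cst 0 z (sol_ode a b) (sol_ode 0 1).
rewrite yz y1z !mul0r subrr !sol0 ?sol'0// !mulr0 !mulr1 subr0 sub0r => -> /eqP.
by rewrite oppr_eq0 => /eqP->.
Qed.

(** Initial data of [S(p) C - C(p) S], where [C] and [S] are the solutions with
    data [(1, 0)] and [(0, 1)]. *)
Definition vanishing_data p := (sol e E 0 1 p, - sol e E 1 0 p).

Lemma vanishing_data_neq0 p : vanishing_data p != (0, 0).
Proof.
rewrite xpair_eqE oppr_eq0; apply/negP => /andP[/eqP S0 /eqP C0].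
have := wronskian_cst p 0 (sol_ode 1 0) (sol_ode 0 1).
rewrite C0 S0 (sol0 1 0 e2 E2) (sol0 0 1 e2 E2) (sol'0 1 0 e2 E2) (sol'0 0 1 e2 E2)
  mul0r !mulr0 mulr1 subrr subr0 => /eqP.
by rewrite eq_sym oner_eq0.
Qed.

Lemma sol_vanishing p : sol e E (vanishing_data p).1 (vanishing_data p).2 p = 0.
Proof. by rewrite sol_lin//=; ring. Qed.

End Sol.
End Flux.

(** * Recessive solutions of the harmonic oscillator *)

Section HalfLine.
Context {R : realType}.

Lemma bounded_growth (f df : R -> R) (a c : R) :
  (forall t : R, a <= t -> is_derive t 1 f (df t)) ->
  (forall t, a <= t -> f t <= 0) -> (forall t, a <= t -> c <= df t) -> c <= 0.
Proof.
move=> fd f0 dfc; rewrite leNgt; apply/negP => c0.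
pose t := a + (`|f a| + 1) / c.
have f1 : 0 < `|f a| + 1 by have := normr_ge0 (f a); lra.
have at_ : a <= t by rewrite /t lerDl divr_ge0 ?ltW.
pose g x := f x - c * x.
have : g a <= g t.
  apply: (@is_derive_nondecreasing _ g (fun x => df x - c)) at_ _ _ => x ax _.
    by have := fd x ax => ?; apply: is_derive_eq; rewrite /GRing.scale /=; lra.
  by rewrite subr_ge0 dfc.
have -> : g t = f t - c * a - (`|f a| + 1).
  by rewrite /g /t mulrDr [c * (_ / c)]mulrC divfK ?gt_eqF//; lra.
rewrite /g; have := f0 t at_; have := ler_norm (- f a); rewrite normrN; lra.
Qed.

(** Real form of: an oscillator solution [f'' = (t^2 - 7/4) f] which is
    recessive at infinity is strictly increasing in modulus at the origin.
    Here [G], [P] stand for the squared moduli of [f] and [f'], and [L + i J]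
    for [f'] times the conjugate of [f]. *)
Lemma oscillator_recessive (G P L : R -> R) (J : R) :
  (forall t : R, is_derive t 1 G (2 * L t)) ->
  (forall t : R, is_derive t 1 L (P t + (t ^+ 2 - 7 / 4) * G t)) ->
  (forall t, P t * G t = L t ^+ 2 + J ^+ 2) ->
  (forall t, 0 <= P t) -> (forall t, 0 <= G t) -> (forall t, G t = 0 -> 0 < P t) ->
  (forall t, 2 <= t -> L t <= 0) -> 0 < L 0.
Proof.
move=> Gd Ld PG P0 G0 nz L2; rewrite ltNge; apply/negP => L0.
(* Otherwise [L' >= P + G >= 2 |J|] makes [L] unbounded on [2, oo). *)
have J0 : J = 0.
  apply/eqP; rewrite -normr_le0.
  suff : 2 * `|J| <= 0 by lra.
  apply: (@bounded_growth L _ 2 _ (fun t _ => Ld t) L2) => t t2.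
  have Pt := P0 t; have Gt := G0 t.
  have : (2 * `|J|) <= P t + G t.
    rewrite -(@ler_pXn2r _ 2) ?nnegrE ?mulr_ge0 ?addr_ge0//.
    rewrite exprMn real_normK ?num_real//; have := PG t; have := sqr_ge0 (P t - G t).
    have := sqr_ge0 (L t); lra.
  have : 0 <= (t ^+ 2 - 11 / 4) * G t by rewrite mulr_ge0//; nra.
  lra.
have LPG t : L t ^+ 2 = P t * G t by rewrite PG J0; lra.
(* A solution on the whole half-line of [k' + k^2 <= t^2 - 7/4]. *)
pose k (t : R) := (2 * t + 1)^-1 - t.
(* From a zero on, the nondecreasing [M = L - k G] would be bounded below by a
   positive constant; with [L <= 0] this bounds [t G] from below, and then [L']. *)
have nozero t1 : 0 <= t1 -> 0 < G t1.
  move=> t10; rewrite lt_def G0 andbT; apply/eqP => Gt1.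
  have Lt1 : L t1 = 0.
    by apply/eqP; rewrite -sqrf_eq0 LPG Gt1 mulr0.
  pose M t := L t - k t * G t.
  pose dM t := (P t - 2 * k t * L t + k t ^+ 2 * G t) + (2^-1 - (2 * t + 1)^-1) ^+ 2 * G t.
  have Md (t : R) : 0 <= t -> is_derive t 1 M (dM t).
    move=> t0; have := Gd t; have := Ld t => ? ?.
    have t1n : 2 * t + 1 != 0 by rewrite gt_eqF//; lra.
    apply: is_derive_eq; rewrite /GRing.scale /= /dM /k.
    move: (G t) (P t) (L t) => g p l; field.
    exact: t1n.
  have dM0 t : 0 <= dM t.
    apply: addr_ge0; last by apply: mulr_ge0; [exact: sqr_ge0|exact: G0].
    have := G0 t; rewrite le_eqVlt => /orP[/eqP Gt|Gt].
      have : L t = 0 by apply/eqP; rewrite -sqrf_eq0 LPG -Gt mulr0.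
      by rewrite -Gt => ->; rewrite !mulr0 subr0 addr0.
    rewrite -(pmulr_lge0 _ Gt); have := LPG t; have := sqr_ge0 (L t - k t * G t); lra.
  have Mt1 : M t1 = 0 by rewrite /M Lt1 Gt1; lra.
  have mu0 : 0 < M (t1 + 1).
    rewrite -Mt1; have t11 : t1 < t1 + 1 by lra.
    apply: (@is_derive_increasing _ M dM _ _ t11) => [x xt _|x _ _|].
    - by apply: Md; lra.
    - exact: dM0.
    - by rewrite /dM Gt1 Lt1 !mulr0 subr0 !addr0; exact: nz.
  have Mmu t : t1 + 1 <= t -> M (t1 + 1) <= M t.
    move=> tt; apply: (@is_derive_nondecreasing _ M dM _ _ tt) => x xt _; last exact: dM0.
    by apply: Md; lra.
  suff : M (t1 + 1) <= 0 by lra.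
  apply: (@bounded_growth L _ (t1 + 3) _ (fun t _ => Ld t)) => t tt; first by apply: L2; lra.
  have Mt : M (t1 + 1) <= M t by apply: Mmu; lra.
  have Lt : L t <= 0 by apply: L2; lra.
  have Gt := G0 t; have Pt := P0 t.
  have tG : M (t1 + 1) <= t * G t.
    have : 0 <= (2 * t + 1)^-1 * G t by rewrite mulr_ge0// invr_ge0; lra.
    rewrite /M /k in Mt *; lra.
  nra.
(* Since [J = 0], [s - t] is the logarithmic derivative of [f]; adding [t]
   removes the decay of the ground state [exp (- t^2 / 2)]. *)
pose s t := L t / G t + t.
pose ds t := - s t ^+ 2 + 2 * t * s t - 3 / 4.
have sd (t : R) : 0 <= t -> is_derive t 1 s (ds t).
  move=> t0; have := nozero t t0 => Gt; have := Gd t; have := Ld t => ? ?.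
  have Gn : G t != 0 by rewrite gt_eqF.
  apply: is_derive_eq; rewrite /GRing.scale /= /ds /s.
  have -> : P t = L t ^+ 2 / G t by rewrite LPG mulfK.
  move: (G t) (L t) Gn => g l gn; field.
  exact: gn.
(* [s exp (- t^2)] is nonincreasing. *)
have s0 t : 0 <= t -> s t <= 0.
  move=> t0; pose g x := - (s x * expR (- x ^+ 2)).
  suff : g 0 <= g t.
    rewrite /g /s addr0 lerN2 => sg.
    have : s t * expR (- t ^+ 2) <= 0.
      apply: le_trans sg _; rewrite mulr_le0_ge0 ?expR_ge0//.
      by rewrite mulr_le0_ge0// invr_ge0.
    by rewrite pmulr_lle0 ?expR_gt0.
  apply: (@is_derive_nondecreasing _ g (fun x => (s x ^+ 2 + 3 / 4) * expR (- x ^+ 2))) t0 _ _ => x x0 _.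
    have := sd x x0 => ?; apply: is_derive_eq; rewrite /GRing.scale /= /ds; ring.
  by rewrite mulr_ge0 ?expR_ge0// addr_ge0 ?sqr_ge0//; lra.
apply: (@riccati_blowup _ s ds 0 sd) => t t0.
by rewrite /ds; have := s0 t t0; nra.
Qed.
End HalfLine.

(** * Limits of families of solutions *)

Section Compactness.
Context {R : realType}.

Lemma ctends_conj (I : Type) (F : set_system I) (u : I -> R[i]) l :
  ctends F u l -> ctends F (fun i => (u i)^*) l^*.
Proof.
move=> ul e /ul; congr nbhs; apply/funext => i /=.
by rewrite -rmorphB cabs_conj.
Qed.

Section Ultra.
Context (I : Type) (U : set_system I) {UU : UltraFilter U}.

Let UF : ProperFilter U := ultra_proper.
Existing Instance UF.

Lemma ctends_Re_le (u : I -> R[i]) l c : ctends U u l ->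
  (\forall i \near U, complex.Re (u i) <= c) -> complex.Re l <= c.
Proof.
move=> ul uc; rewrite leNgt; apply/negP => lc.
have e0 : 0 < complex.Re l - c by rewrite subr_gt0.
have [i [ui le]] := filter_ex (filterI uc (ul _ e0)).
have := le_lt_trans (Re_cabs _) le; case: (u i) l ui {ul lc e0 le} => ? ? [? ?] /= ?.
rewrite ltr_norml => /andP[]; lra.
Qed.

Lemma ultra_bounded (x : I -> R) (lo hi : R) : (forall i, lo <= x i <= hi) ->
  exists2 l, lo <= l <= hi & ctends U (fun i => (x i)%:C) l%:C.
Proof.
move=> xb.
have PF : ProperFilter (x @ U) by apply: fmap_proper_filter.
have := @segment_compact R lo hi (x @ U) PF.
case; first by apply: nearW => i /=; rewrite in_itv /=; exact: xb.
move=> l []; rewrite /= in_itv /= => lb cl; exists l => // e e0.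
have [//|H] := in_ultra_setVsetC [set i | cabs ((x i)%:C - l%:C) < e] UU.
exfalso.
have [t [/= Ht lt]] : [set t | ~ (`|t - l| < e)] `&` ball l e !=set0.
  apply: cl (nbhsx_ballx l e e0).
  by rewrite /nbhs /=; apply: filterS H => i /=; rewrite -rmorphB cabs_real.
by apply: Ht; rewrite distrC.
Qed.

Lemma ultra_cbounded (u : I -> R[i]) (A : R) : (forall i, cabs (u i) <= A) ->
  exists l, ctends U u l.
Proof.
move=> uA.
have [|a _ ua] := @ultra_bounded (fun i => complex.Re (u i)) (- A) A.
  by move=> i; rewrite -ler_norml; apply: le_trans (Re_cabs _) _.
have [|b _ ub] := @ultra_bounded (fun i => complex.Im (u i)) (- A) A.
  by move=> i; rewrite -ler_norml; apply: le_trans (Im_cabs _) _.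
exists (a +i* b) => e e0; have e2 : 0 < e / 2 by lra.
apply: filterS2 (ua _ e2) (ub _ e2) => i; rewrite -!rmorphB !cabs_real => h1 h2.
apply: le_lt_trans (cabs_ReIm _) _; move: h1 h2; case: (u i) => ? ? /=; lra.
Qed.

Section Family.
Variables (e E : I -> R) (a b : I -> R[i]) (e0 lo hi : R).
Hypotheses (e01 : forall i, 0 <= e i <= 1) (ee0 : ctends U (fun i => (e i)%:C) e0%:C).
Hypotheses (lo0 : 0 <= lo) (hi2 : hi <= 2) (Eb : forall i, lo <= E i <= hi).
Hypothesis (ab1 : forall i, cabs (a i) + cabs (b i) = 1).

(** Along an ultrafilter all the bounded parameters converge at once, without
    extraction of subsequences, and bounds on the flux pass to the limit. *)
Lemma sol_compactness : exists (E0 : R) (a0 b0 : R[i]),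
  [/\ lo <= E0 <= hi, (a0, b0) != (0, 0), ctends U a a0, ctends U b b0 &
    forall Om z c,
     (\forall i \near U, flux (sol (e i) (E i) (a i) (b i)) (sol' (e i) (E i) (a i) (b i)) Om z <= c) ->
     flux (sol e0 E0 a0 b0) (sol' e0 E0 a0 b0) Om z <= c].
Proof.
have e2 i : `|e i| <= 2 by have /andP[? ?] := e01 i; rewrite ger0_norm//; lra.
have E2 i : `|E i| <= 2.
  by have h0 := lo0; have h2 := hi2; have /andP[? ?] := Eb i; rewrite ger0_norm//; lra.
have aA i : cabs (a i) <= 1 by have := ab1 i; have := cabs_ge0 (b i); lra.
have bA i : cabs (b i) <= 1 by have := ab1 i; have := cabs_ge0 (a i); lra.
have [E0 E0b EE0] := ultra_bounded Eb.
have [a0 aa0] := ultra_cbounded aA; have [b0 bb0] := ultra_cbounded bA.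
have [e0' e01' ee0'] := ultra_bounded e01.
have e0e : e0 = e0'.
  apply/eqP; rewrite -subr_eq0 -normr_le0 leNgt; apply/negP => d0.
  have d2 : 0 < `|e0 - e0'| / 2 by lra.
  have [i []] := filter_ex (filterI (ee0 d2) (ee0' _ d2)).
  rewrite -!rmorphB !cabs_real => h1 h2.
  have := ler_normB (e i - e0') (e i - e0).
  have -> : e i - e0' - (e i - e0) = e0 - e0' by ring.
  lra.
have e02 : `|e0| <= 2.
  by rewrite e0e; move: e01' => /andP[? ?]; rewrite ger0_norm//; lra.
have E02 : `|E0| <= 2 by have h0 := lo0; have h2 := hi2; move: E0b => /andP[? ?]; rewrite ger0_norm; lra.
exists E0, a0, b0; split => //.
  apply/eqP => -[a00 b00]; have h : 0 < 1 / 2 :> R by lra.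
  have [i []] := filter_ex (filterI (aa0 _ h) (bb0 _ h)).
  by rewrite a00 b00 !subr0; have := ab1 i; lra.
move=> Om z c; apply: ctends_Re_le.
apply: ctendsM; first exact: ctends_cst.
apply: ctendsM; first exact: ctends_sol' aA bA _ _ _ _ _ _ _.
by apply: ctends_conj; exact: ctends_sol aA bA _ _ _ _ _ _ _.
Qed.

End Family.
End Ultra.
End Compactness.

Section Recessive.
Context {R : realType}.
Implicit Types (e E s t : R) (a b : R[i]).

Local Notation flx e E a b := (flux (sol e E a b) (sol' e E a b)).

Lemma flux_vertical_1 e E a b s t : 0 <= e -> `|e| <= 2 -> `|E| <= 2 -> 0 <= s -> s <= t ->
  flx e E a b 1 (0 +i* s) <= flx e E a b 1 (0 +i* t).
Proof.
move=> e0 e2 E2 s0 st.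
have -> : (0 +i* t : R[i]) = (0 +i* s) + (0 +i* (t - s)).
  by apply/eqP; rewrite eq_complex /=; apply/andP; split; apply/eqP; ring.
apply: flux_le; first exact: sol_ode.
  by rewrite /= !mul1r; lra.
move=> r r0 r1.
have -> : (0 +i* s) + r%:C * (0 +i* (t - s)) = 0 +i* (s + r * (t - s)) :> R[i].
  by apply/eqP; rewrite eq_complex /=; apply/andP; split; apply/eqP; ring.
rewrite mul1r; rewrite cubicE /= /Im_cubic.
have p0 : 0 <= e * (s + r * (t - s)) ^+ 3 * (t - s).
  apply: mulr_ge0; last by rewrite subr_ge0.
  apply: mulr_ge0 => //; apply: exprn_ge0; apply: addr_ge0 => //.
  by apply: mulr_ge0; rewrite ?subr_ge0.
lra.
Qed.

Lemma flux_vertical_i e E a b s t : `|e| <= 2 -> `|E| <= 2 -> E <= s ^+ 2 -> 0 <= s -> s <= t ->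
  flx e E a b 'i (0 +i* s) <= flx e E a b 'i (0 +i* t).
Proof.
move=> e2 E2 Es s0 st.
have -> : (0 +i* t : R[i]) = (0 +i* s) + (0 +i* (t - s)).
  by apply/eqP; rewrite eq_complex /=; apply/andP; split; apply/eqP; ring.
apply: flux_le; first exact: sol_ode.
  by rewrite /=; lra.
move=> r r0 r1.
have -> : (0 +i* s) + r%:C * (0 +i* (t - s)) = 0 +i* (s + r * (t - s)) :> R[i].
  by apply/eqP; rewrite eq_complex /=; apply/andP; split; apply/eqP; ring.
rewrite cubicE /= /Re_cubic.
have rts : 0 <= r * (t - s) by rewrite mulr_ge0 ?subr_ge0.
have p0 : 0 <= (t - s) * ((s + r * (t - s)) ^+ 2 - E).
  rewrite mulr_ge0 ?subr_ge0//; apply: le_trans Es _.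
  by rewrite lerXn2r ?nnegrE ?addr_ge0// lerDl.
lra.
Qed.

End Recessive.

(** * Existence of the eigenfunction *)

Section Eigenvalue.
Context {R : realType}.
Implicit Types (e E s t : R) (N M : nat).

Local Notation flx e E a b := (flux (sol e E a b) (sol' e E a b)).

Lemma cabs2_derive (y y1 : R[i] -> R[i]) z d (r : R) : cderiv y y1 ->
  is_derive r 1 (fun r => cabs (y (z + r%:C * d)) ^+ 2) (2 * flux y y1 d (z + r%:C * d)).
Proof.
move=> yd; have [f1d f2d] := is_derive_line z d r yd.
have -> : (fun r => cabs (y (z + r%:C * d)) ^+ 2) = (fun r : R =>
   complex.Re (y (z + r%:C * d)) ^+ 2 + complex.Im (y (z + r%:C * d)) ^+ 2).
  by apply/funext => s; rewrite cabs_sqr.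
apply: is_derive_eq; rewrite /flux.
set p := z + _; move: (y p) (y1 p); clear - d.
case: d => [? ?] [? ?] [? ?].
by rewrite /GRing.scale /=; ring.
Qed.

Lemma flux_scale e E (k : R) (a b Om z : R[i]) : `|e| <= 2 -> `|E| <= 2 ->
  flx e E (k%:C * a) (k%:C * b) Om z = k ^+ 2 * flx e E a b Om z.
Proof.
move=> e2 E2; rewrite /flux sol_lin// [sol _ _ a b z]sol_lin// sol'_lin// [sol' _ _ a b z]sol'_lin//.
move: (sol e E 1 0 z) (sol e E 0 1 z) (sol' e E 1 0 z) (sol' e E 0 1 z).
case: a b Om => [? ?] [? ?] [? ?] [? ?] [? ?] [? ?] [? ?] /=; ring.
Qed.

Lemma flux_derive_axis Q (y y1 : R[i] -> R[i]) Om (t : R) : ode Q y y1 ->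
  is_derive t 1 (fun t => flux y y1 Om (0 +i* t))
   (complex.Re (Om * 'i^*) * cabs (y1 (0 +i* t)) ^+ 2 +
    complex.Re (Om * 'i * Q (0 +i* t)) * cabs (y (0 +i* t)) ^+ 2).
Proof.
move=> /(flux_derive Om 0 'i t).
have ax (s : R) : 0 + s%:C * 'i = 0 +i* s.
  by apply/eqP; rewrite eq_complex /=; apply/andP; split; apply/eqP; ring.
by have -> : (fun s => flux y y1 Om (0 + s%:C * 'i)) = (fun s => flux y y1 Om (0 +i* s));
  [apply/funext => s|]; rewrite ax.
Qed.

Lemma cabs2_derive_vertical (y y1 : R[i] -> R[i]) (x t : R) : cderiv y y1 ->
  is_derive t 1 (fun t => cabs (y (x +i* t)) ^+ 2) (2 * flux y y1 'i (x +i* t)).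
Proof.
move=> /(cabs2_derive (x +i* 0) 'i t).
have ax (s : R) : (x +i* 0) + s%:C * 'i = x +i* s.
  by apply/eqP; rewrite eq_complex /=; apply/andP; split; apply/eqP; ring.
by have -> : (fun s => cabs (y ((x +i* 0) + s%:C * 'i)) ^+ 2) = (fun s => cabs (y (x +i* s)) ^+ 2);
  [apply/funext => s|]; rewrite ax.
Qed.

Lemma oscillator_flux (a b : R[i]) : (a, b) != (0, 0) ->
  (forall t, 2 <= t -> flx 0 (7 / 4) a b 'i (0 +i* t) <= 0) ->
  0 < flx 0 (7 / 4) a b 'i 0.
Proof.
move=> ab0 L2.
have e2 : `|0 : R| <= 2 by rewrite normr0.
have E2 : `|7 / 4 : R| <= 2 by rewrite ger0_norm; lra.
have yS := sol_ode e2 E2 a b.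
set y := sol _ _ a b in L2 yS *; set y1 := sol' _ _ a b in L2 yS *.
have Jd (t : R) : is_derive t 1 (fun t => flux y y1 1 (0 +i* t)) 0.
  have d1 := flux_derive_axis 1 t yS.
  apply: is_derive_eq; rewrite mul1r.
  rewrite cubicE /= /Im_cubic; lra.
have J (t : R) : flux y y1 1 (0 +i* t) = flux y y1 1 (0 +i* 0).
  exact: is_derive0_cst t 0 Jd.
have Gd (t : R) := cabs2_derive_vertical 0 t (proj1 yS).
have Ld (t : R) : is_derive t 1 (fun t => flux y y1 'i (0 +i* t))
    (cabs (y1 (0 +i* t)) ^+ 2 + (t ^+ 2 - 7 / 4) * cabs (y (0 +i* t)) ^+ 2).
  have d1 := flux_derive_axis 'i t yS.
  apply: is_derive_eq.
  rewrite cubicE /= /Re_cubic; ring.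
have PG (t : R) : cabs (y1 (0 +i* t)) ^+ 2 * cabs (y (0 +i* t)) ^+ 2 =
    flux y y1 'i (0 +i* t) ^+ 2 + flux y y1 1 (0 +i* 0) ^+ 2.
  rewrite -(J t) /flux !cabs_sqr.
  by move: (y _) (y1 _) => [? ?] [? ?] /=; ring.
apply: (oscillator_recessive Gd Ld PG) L2 => t.
- by rewrite exprn_ge0 ?cabs_ge0.
- by rewrite exprn_ge0 ?cabs_ge0.
- move=> /eqP; rewrite sqrf_eq0 cabs_eq0 => /eqP yt.
  by rewrite exprn_gt0// lt_def cabs_ge0 cabs_eq0 andbT; exact: (sol_simple_zero e2 E2 ab0 yt).
Qed.

(** This number vanishes exactly when the solution vanishing at [p] is a
    multiple of a real one. *)
Definition mismatch e E p : R :=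
  flx e E (vanishing_data e E p).1 (vanishing_data e E p).2 'i 0.

Lemma mismatchE e E p : `|e| <= 2 -> `|E| <= 2 ->
  mismatch e E p = complex.Re ('i * (- sol e E 1 0 p * (sol e E 0 1 p)^*)).
Proof. by move=> e2 E2; rewrite /mismatch /flux sol0// sol'0. Qed.

(** The normalization brings the initial data into a compact set; the flux is
    quadratic in the data, so it keeps its sign. *)
Lemma vanishing_normalized e E p : `|e| <= 2 -> `|E| <= 2 -> exists a b : R[i],
  [/\ cabs a + cabs b = 1, sol e E a b p = 0 &
    exists2 k : R, 0 < k & flx e E a b 'i 0 = k * mismatch e E p].
Proof.
move=> e2 E2; have := vanishing_data_neq0 e2 E2 p; have := sol_vanishing e2 E2 p.
rewrite /mismatch; case: vanishing_data => a b /= yp ab0.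
pose l := cabs a + cabs b.
have l0 : 0 < l.
  rewrite lt_def addr_ge0 ?cabs_ge0// andbT; apply: contra ab0.
  by rewrite paddr_eq0 ?cabs_ge0// !cabs_eq0 xpair_eqE.
exists ((l^-1)%:C * a), ((l^-1)%:C * b); split.
- by rewrite !cabsMr -mulrDr ger0_norm ?invr_ge0 ?ltW// mulVf// gt_eqF.
- move: yp; rewrite sol_lin// [sol e E (_ * _) _ _]sol_lin// => yp.
  by rewrite -!mulrA -mulrDr yp mulr0.
- exists (l^-1 ^+ 2); first by rewrite exprn_gt0// invr_gt0.
  exact: flux_scale.
Qed.

(** At energy 0 the flux is nondecreasing along the whole imaginary axis, up to
    the value 0 at the zero of the solution. *)
Lemma mismatch_le0 e N : 0 <= e <= 1 -> mismatch e 0 (0 +i* N%:R) <= 0.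
Proof.
move=> /andP[e0 e1]; have e2 : `|e| <= 2 by rewrite ger0_norm//; lra.
have E2 : `|0 : R| <= 2 by rewrite normr0.
rewrite /mismatch; apply: le_trans (flux_vertical_i _ _ e2 E2 _ (lexx 0) (ler0n _ N)) _.
  by rewrite expr0n.
by rewrite flux0// sol_vanishing.
Qed.

(** Otherwise the mismatch is negative for some [e_k -> 0] and [N_k -> oo]; a
    limit of the corresponding solutions is a recessive solution of the
    oscillator which contradicts [oscillator_flux]. *)
Lemma mismatch_ge0 : exists2 e0 : R, 0 < e0 <= 1 &
  forall e, 0 < e <= e0 -> forall M, exists2 N, (M <= N)%N & 0 <= mismatch e (7 / 4) (0 +i* N%:R).
Proof.
apply: contrapT => H.
have E2 : `|7 / 4 : R| <= 2 by rewrite ger0_norm; lra.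
have {}H (k : nat) : exists eN : R * nat, [/\ 0 <= eN.1 <= 1, eN.1 <= k.+1%:R^-1, (k <= eN.2)%N &
    mismatch eN.1 (7 / 4) (0 +i* eN.2%:R) < 0].
  apply: contrapT => Hk; apply: H; exists k.+1%:R^-1 => [|e /andP[e0 ek] M].
    by rewrite invr_gt0 ltr0n invf_le1 ?ltr0n// ler1n.
  have k1 : k.+1%:R^-1 <= 1 :> R by rewrite invf_le1 ?ltr0n// ler1n.
  apply: contrapT => HM; apply: Hk; exists (e, maxn M k); split => //=.
  - by rewrite (ltW e0) (le_trans ek).
  - exact: leq_maxr.
  - by rewrite ltNge; apply/negP => ge0; apply: HM; exists (maxn M k) => //; exact: leq_maxl.
have {H}[f Hf] := choice H.
have e01 k : 0 <= (f k).1 <= 1 by have [] := Hf k.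
have e2 k : `|(f k).1| <= 2 by have /andP[? ?] := e01 k; rewrite ger0_norm//; lra.
have {}Hv k : exists ab : R[i] * R[i], [/\ cabs ab.1 + cabs ab.2 = 1,
    sol (f k).1 (7 / 4) ab.1 ab.2 (0 +i* (f k).2%:R) = 0 &
    flx (f k).1 (7 / 4) ab.1 ab.2 'i 0 <= 0].
  have [a [b [ab1 yp [l l0 fl]]]] := vanishing_normalized (0 +i* (f k).2%:R) (e2 k) E2.
  exists (a, b); split => //=; rewrite fl; have [_ _ _ neg] := Hf k.
  by rewrite pmulr_rle0// ltW.
have {Hv}[ab Hab] := choice Hv.
have [U [UU Uoo]] := ultraFilterLemma eventually_filter.
have ee0 : ctends U (fun k => ((f k).1)%:C) (0 : R)%:C.
  move=> d d0; apply: Uoo; exists (Num.truncn d^-1).+1 => // k /= dk.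
  rewrite -rmorphB cabs_real subr0; have [/andP[f0 _] fk _ _] := Hf k.
  rewrite ger0_norm//; apply: le_lt_trans fk _.
  rewrite invf_plt ?posrE ?ltr0n//; apply: lt_le_trans (truncnS_gt _) _.
  by rewrite ler_nat leqW.
have ab1 k : cabs (ab k).1 + cabs (ab k).2 = 1 by have [] := Hab k.
have lo0 : 0 <= 7 / 4 :> R by lra.
have hi2 : 7 / 4 <= 2 :> R by lra.
have Eb (k : nat) : 7 / 4 <= (7 / 4 : R) <= 7 / 4 by rewrite lexx.
have {Eb}[E0 [a0 [b0 [E0b ab0 _ _ lim]]]] := sol_compactness e01 ee0 lo0 hi2 Eb ab1.
have {}E0b : E0 = 7 / 4 by apply/eqP; rewrite eq_le andbC.
rewrite E0b in lim.
have UF : Filter U := @ultra_proper _ _ UU.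
have : 0 < flx 0 (7 / 4) a0 b0 'i 0.
  apply: oscillator_flux => // t t2; apply: lim.
  apply: Uoo; exists (Num.truncn t).+1 => // k /= tk.
  have [_ _ kN _] := Hf k; have [_ yp _] := Hab k.
  apply: le_trans (flux_vertical_i _ _ (e2 k) E2 _ _ (_ : t <= (f k).2%:R)) _.
  - nra.
  - lra.
  - by apply: ltW; apply: lt_le_trans (truncnS_gt _) _; rewrite ler_nat (leq_trans tk).
  - by rewrite flux0.
rewrite ltNge => /negP; apply; apply: lim; apply: nearW => k.
by have [] := Hab k.
Qed.

(** The energy is clamped to the interval of interest, outside of which the
    solutions are not controlled uniformly. *)
Lemma mismatch_continuous e p : 0 <= e <= 1 ->
  continuous (fun x : R => mismatch e (Num.max 0 (Num.min x (7 / 4))) p).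
Proof.
move=> /andP[e0 e1] x.
have e2 : `|e| <= 2 by rewrite ger0_norm//; lra.
pose cl (x : R) := Num.max 0 (Num.min x (7 / 4)).
have cl2 x' : `|cl x'| <= 2.
  rewrite ger0_norm /cl ?le_max ?lexx// ge_max ge_min; apply/andP; split; first by lra.
  by apply/orP; right; lra.
have clx : ctends (nbhs x) (fun x => (cl x)%:C) (cl x)%:C.
  move=> d d0; apply/nbhs_ballP; exists d => // x' xx'.
  have {}xx' : `|x - x'| < d := xx'.
  rewrite -rmorphB cabs_real; apply: le_lt_trans xx'.
  have h (u v : R) : u <= v -> `|cl u - cl v| <= `|u - v|.
    move=> uv; rewrite (ler0_norm (_ : u - v <= 0)) ?subr_le0// ler_norml /cl.
    case: (lerP u (7 / 4)) => ?; case: (lerP v (7 / 4)) => ?;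
      case: (lerP 0 u) => ?; case: (lerP 0 v) => ?;
      rewrite ?(max_r (_ : 0 <= 7 / 4 :> R)); try lra; apply/andP; split; lra.
  have [/h hh|/ltW/h//] := leP x' x.
    by rewrite (distrC x); exact: hh.
  by rewrite distrC.
have e2' (x' : R) : `|(fun=> e) x'| <= 2 by [].
apply/cvgrPdist_lt => d d0.
have A1 : forall x' : R, cabs (1 : R[i]) <= 1 by rewrite cabs_real normr1.
have A0 : forall x' : R, cabs (0 : R[i]) <= 1 by rewrite cabs0.
have FF : Filter (nbhs x) := nbhs_filter x.
have cC : ctends (nbhs x) (fun i => sol e (cl i) 1 0 p) (sol e (cl x) 1 0 p).
  by apply: (ctends_sol e2' cl2 A1 A0 e2 (cl2 x) _ clx); exact: ctends_cst.
have cS : ctends (nbhs x) (fun i => sol e (cl i) 0 1 p) (sol e (cl x) 0 1 p).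
  by apply: (ctends_sol e2' cl2 A0 A1 e2 (cl2 x) _ clx); exact: ctends_cst.
have : ctends (nbhs x) (fun i => 'i * (-1 * sol e (cl i) 1 0 p * (sol e (cl i) 0 1 p)^*))
    ('i * (-1 * sol e (cl x) 1 0 p * (sol e (cl x) 0 1 p)^*)).
  apply: ctendsM; first exact: ctends_cst.
  apply: ctendsM; last exact: ctends_conj.
  by apply: ctendsM => //; exact: ctends_cst.
move=> /(_ d d0); apply: filterS => x' /=; rewrite !mulN1r => h.
rewrite distrC (mismatchE _ e2 (cl2 x)) (mismatchE _ e2 (cl2 x')).
apply: le_lt_trans h; apply: le_trans (Re_cabs _).
by case: ('i * _) ('i * _) => [? ?] [? ?].
Qed.

Lemma real_vanishing_data (Cp Sp : R[i]) : complex.Re ('i * (- Cp * Sp^*)) = 0 ->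
  exists a b : R, `|a| + `|b| = 1 /\ a%:C * Cp + b%:C * Sp = 0.
Proof.
move=> H.
have norm (a b : R) : (a, b) != (0, 0) -> a%:C * Cp + b%:C * Sp = 0 ->
    exists a b : R, `|a| + `|b| = 1 /\ a%:C * Cp + b%:C * Sp = 0.
  move=> ab0 h; pose l := `|a| + `|b|.
  have l0 : 0 < l.
    rewrite lt_def addr_ge0// andbT; apply: contra ab0.
    by rewrite paddr_eq0// !normr_eq0 xpair_eqE.
  exists (l^-1 * a), (l^-1 * b); split.
    by rewrite !normrM -mulrDr ger0_norm ?invr_ge0 ?ltW// mulVf// gt_eqF.
  by rewrite !rmorphM -!mulrA -mulrDr h mulr0.
have [S0|S0] := eqVneq Sp 0.
  by apply: (norm 0 1); rewrite ?S0 ?mulr0 ?mul0r ?addr0// xpair_eqE oner_eq0 andbF.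
apply: (norm (cabs Sp ^+ 2) (- complex.Re (Cp * Sp^*))).
  by rewrite xpair_eqE sqrf_eq0 cabs_eq0 (negbTE S0).
rewrite cabs_sqr; move: H {norm S0}; case: Cp Sp => [c1 c2] [s1 s2] /= H.
apply/eqP; rewrite eq_complex /=; apply/andP; split; apply/eqP.
- have H' : c1 * s2 - c2 * s1 = 0 by lra.
  by transitivity (s2 * (c1 * s2 - c2 * s1)); [ring|rewrite H' mulr0].
- have H' : c1 * s2 - c2 * s1 = 0 by lra.
  by transitivity (- s1 * (c1 * s2 - c2 * s1)); [ring|rewrite H' mulr0].
Qed.

Lemma IVT0 (g : R -> R) (lo hi : R) : lo <= hi -> continuous g -> g lo <= 0 -> 0 <= g hi ->
  exists2 c, lo <= c <= hi & g c = 0.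
Proof.
move=> lohi gc glo ghi.
have gc' : {within `[lo, hi], continuous g} by apply: continuous_subspaceT.
have [|c] := @IVT R g lo hi 0 lohi gc'; first by rewrite ge_min glo le_max ghi orbT.
by rewrite in_itv /= => cb gc0; exists c.
Qed.

(** The intermediate value theorem between the energies 0 and 7/4. *)
Lemma real_dirichlet e N : 0 <= e <= 1 -> 0 <= mismatch e (7 / 4) (0 +i* N%:R) ->
  exists E a b : R, [/\ 0 <= E <= 7 / 4, `|a| + `|b| = 1 & sol e E a%:C b%:C (0 +i* N%:R) = 0].
Proof.
move=> e01 m0.
have e2 : `|e| <= 2.
  move: e01 => /andP[? ?]; rewrite ger0_norm//.
  by apply: le_trans (_ : 1 <= 2) => //; exact: ler1n.
have a0 : 0 <= 7 / 4 :> R by clear; lra.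
pose g x := mismatch e (Num.max 0 (Num.min x (7 / 4))) (0 +i* N%:R).
have g0 : g 0 <= 0 by rewrite /g (min_l a0) maxxx mismatch_le0.
have g1 : 0 <= g (7 / 4) by rewrite /g minxx (max_r a0).
have gc : continuous g by exact: mismatch_continuous.
have [E /andP[E0 E1]] := IVT0 a0 gc g0 g1.
rewrite /g.
rewrite (min_l E1) (max_r E0) => gE.
have E2 : `|E| <= 2 by rewrite ger0_norm//; clear - E1; lra.
rewrite (mismatchE _ e2 E2) in gE.
have [a [b [ab1 abp]]] := real_vanishing_data gE.
by exists E, a, b; split; [rewrite E0 E1|exact: ab1|rewrite sol_lin].
Qed.

(** The trace left on the fluxes by the decay of [y] towards [+ i oo]; it is
    stable under limits and is all that the location of the zeros needs. *)
Definition recessive e E (a b : R) :=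
  (forall t, 0 <= t -> flx e E a%:C b%:C 1 (0 +i* t) <= 0) /\
  (forall t, 2 <= t -> flx e E a%:C b%:C 'i (0 +i* t) <= 0).

Lemma exists_recessive : exists2 e0 : R, 0 < e0 <= 1 & forall e, 0 < e <= e0 ->
  exists E a b : R, [/\ 0 <= E <= 7 / 4, (a, b) != (0, 0) & recessive e E a b].
Proof.
have [e0 /andP[e00 e01] H] := mismatch_ge0; exists e0; first by rewrite e00.
move=> e ee0; have e1 : 0 <= e <= 1.
  by move: ee0 => /andP[h1 h2]; rewrite ltW//= (le_trans h2).
have e2 : `|e| <= 2 by move: (e1) => /andP[? ?]; rewrite ger0_norm//; lra.
have {}H (M : nat) : exists f : nat * (R * (R * R)), [/\ (M <= f.1)%N, 0 <= f.2.1 <= 7 / 4,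
   `|f.2.2.1| + `|f.2.2.2| = 1 & sol e f.2.1 f.2.2.1%:C f.2.2.2%:C (0 +i* f.1%:R) = 0].
  have [N MN mN] := H e ee0 M; have [E [a [b [h1 h2 h3]]]] := real_dirichlet e1 mN.
  by exists (N, (E, (a, b))).
have {H}[f Hf] := choice H.
have [U [UU Uoo]] := ultraFilterLemma eventually_filter.
have UF : ProperFilter U := @ultra_proper _ _ UU.
have lo0 : 0 <= 0 :> R by [].
have hi2 : 7 / 4 <= 2 :> R by lra.
have E2 k : `|(f k).2.1| <= 2.
  by have [_ /andP[? ?] _ _] := Hf k; rewrite ger0_norm//; lra.
have Eb k : 0 <= (f k).2.1 <= 7 / 4 by have [] := Hf k.
have ab1 k : cabs ((f k).2.2.1%:C : R[i]) + cabs ((f k).2.2.2%:C : R[i]) = 1.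
  by rewrite !cabs_real; have [] := Hf k.
have e1' (k : nat) : 0 <= (fun=> e) k <= 1 by [].
have {e1'}[E [a [b [Eb' ab0 la lb lim]]]] := sol_compactness e1' (ctends_cst e%:C) lo0 hi2 Eb ab1.
have real_lim (r : nat -> R) (l : R[i]) : ctends U (fun k => (r k)%:C) l -> l = (complex.Re l)%:C.
  move=> rl; suff : complex.Im l = 0 by case: l {rl} => ? ? /= ->.
  apply/eqP; rewrite -normr_le0 leNgt; apply/negP => /rl H.
  have [k] := filter_ex H; rewrite ltNge => /negP; apply.
  apply: le_trans (Im_cabs _); case: l {rl H} => ? ? /=.
  by rewrite sub0r normrN.
exists E, (complex.Re a), (complex.Re b).
rewrite /recessive -(real_lim _ _ la) -(real_lim _ _ lb); split => //.
  apply: contra ab0; rewrite !xpair_eqE => /andP[/eqP ra /eqP rb].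
  by rewrite (real_lim _ _ la) (real_lim _ _ lb) ra rb eqxx.
have near_le t : \forall k \near U, t <= (f k).1%:R.
  apply: Uoo; exists (Num.truncn t).+1 => // k /= tk; have [kN _ _ _] := Hf k.
  by apply: ltW; apply: lt_le_trans (truncnS_gt _) _; rewrite ler_nat (leq_trans tk).
split=> t t0; apply: lim; apply: filterS (near_le t) => k tk; have [_ _ _ yp] := Hf k.
- apply: le_trans (flux_vertical_1 _ _ _ e2 (E2 k) t0 tk) _; last by rewrite flux0.
  by case/andP: e1.
- apply: le_trans (flux_vertical_i _ _ e2 (E2 k) _ _ tk) _; last by rewrite flux0.
    have [_ /andP[_ ?] _ _] := Hf k; nra.
  by lra.
Qed.

End Eigenvalue.

(** * Segments of monotone flux *)

Section Steps.
Context {R : realType}.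
Implicit Types (x t p q u v : R).
Variables (e E : R) (e0 : 0 < e) (e1 : e <= 1) (E0 : 0 <= E) (E1 : E <= 7 / 4).

Ltac hyps := move: (e0) (e1) (E0) (E1) => e_gt0 e_le1 E_ge0 E_le.

Local Notation reQ := (Re_cubic e E).
Local Notation imQ := (Im_cubic e).

Let e2 : `|e| <= 2. Proof. by hyps; rewrite gtr0_norm//; lra. Qed.
Let E2 : `|E| <= 2. Proof. by hyps; rewrite ger0_norm//; lra. Qed.

Section OneSolution.
Variables (a b : R[i]).
Local Notation y := (sol e E a b).
Local Notation y1 := (sol' e E a b).

Lemma flux_lin u v z : flux y y1 (u +i* v) z = u * flux y y1 1 z + v * flux y y1 'i z.
Proof. by rewrite /flux; case: (y z) (y1 z) => [? ?] [? ?] /=; ring. Qed.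

Lemma step_le x t p q u v x' t' : x + p = x' -> t + q = t' -> 0 <= u * p + v * q ->
  (forall r, 0 <= r -> r <= 1 ->
     0 <= (u * p - v * q) * reQ (x + r * p) (t + r * q) -
          (u * q + v * p) * imQ (x + r * p) (t + r * q)) ->
  flux y y1 (u +i* v) (x +i* t) <= flux y y1 (u +i* v) (x' +i* t').
Proof.
move=> <- <- h0 H; change ((x + p) +i* (t + q)) with ((x +i* t) + (p +i* q)).
apply: (flux_le (sol_ode e2 E2 a b)) => [|r r0 r1]; first by rewrite /=; lra.
have -> : (x +i* t) + r%:C * (p +i* q) = (x + r * p) +i* (t + r * q).
  by apply/eqP; rewrite eq_complex /=; apply/andP; split; apply/eqP; ring.
by rewrite cubicE /=; exact: H.
Qed.

Lemma step_lt x t p q u v x' t' : x + p = x' -> t + q = t' -> 0 <= u * p + v * q ->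
  (forall r, 0 <= r -> r <= 1 ->
     0 <= (u * p - v * q) * reQ (x + r * p) (t + r * q) -
          (u * q + v * p) * imQ (x + r * p) (t + r * q)) ->
  0 < (u * p + v * q) * cabs (y1 (x +i* t)) ^+ 2 +
      ((u * p - v * q) * reQ x t - (u * q + v * p) * imQ x t) * cabs (y (x +i* t)) ^+ 2 ->
  flux y y1 (u +i* v) (x +i* t) < flux y y1 (u +i* v) (x' +i* t').
Proof.
move=> <- <- h0 H h1; change ((x + p) +i* (t + q)) with ((x +i* t) + (p +i* q)).
apply: (flux_lt (sol_ode e2 E2 a b)) => [|r r0 r1|]; first by rewrite /=; lra.
  have -> : (x +i* t) + r%:C * (p +i* q) = (x + r * p) +i* (t + r * q).
    by apply/eqP; rewrite eq_complex /=; apply/andP; split; apply/eqP; ring.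
  by rewrite cubicE /=; exact: H.
by rewrite cubicE /=; lra.
Qed.

Lemma no_zero_step x t p q u v x' t' : (a, b) != (0, 0) -> x + p = x' -> t + q = t' ->
  0 < u * p + v * q ->
  (forall r, 0 <= r -> r <= 1 ->
     0 <= (u * p - v * q) * reQ (x + r * p) (t + r * q) -
          (u * q + v * p) * imQ (x + r * p) (t + r * q)) ->
  flux y y1 (u +i* v) (x' +i* t') <= 0 -> y (x +i* t) <> 0.
Proof.
move=> ab0 xp tq h0 H f0 yz; move: f0; apply/negP; rewrite -ltNge.
rewrite -(@flux0 R y y1 (u +i* v) _ yz).
apply: (step_lt xp tq (ltW h0) H).
rewrite yz cabs0 expr0n /= mulr0 addr0 mulr_gt0// exprn_gt0// lt_def cabs_ge0 andbT.
by rewrite cabs_eq0 (sol_simple_zero e2 E2 ab0 yz).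
Qed.

End OneSolution.

(** The pure cubic only needs a slope [t / x] above [tan (pi / 6)], which is less
    than 2/3; the lower bound on [t] absorbs the lower order terms. *)
Lemma reQ_le0 x t : 0 <= x -> 2 * x <= 3 * t -> 3 + 2 * e <= e * t -> reQ x t <= 0.
Proof.
hyps; move=> x0 xt et; rewrite /Re_cubic.
have t2 : 2 < t by rewrite -(ltr_pM2l e0); lra.
have [ex|ex] := leP (8 / 3) (e * x).
- have h1 : 0 <= e * x * (9 / 4 * t ^+ 2 - x ^+ 2).
    by rewrite mulr_ge0//; [lra|nra].
  have h2 : 0 <= (e * x - 8 / 3) * t ^+ 2 by rewrite mulr_ge0 ?sqr_ge0//; lra.
  nra.
- have tx : x + 2 <= t by rewrite -(ler_pM2l e0) mulrDr; lra.
  have h1 : 0 <= e * x * (3 * t ^+ 2 - x ^+ 2).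
    by rewrite mulr_ge0//; [rewrite mulr_ge0// ltW|nra].
  nra.
Qed.

Lemma diag_ge0 u t : 0 <= u -> 3 * e * u <= 1 -> 3 <= e * t -> 0 <= reQ (- u) t - imQ (- u) t.
Proof.
hyps; move=> u0 eu et; rewrite /Re_cubic /Im_cubic.
have t0 : 0 < t by rewrite -(pmulr_rgt0 _ e0); lra.
have h1 : 0 <= (e * t - 3) * t ^+ 2 by rewrite mulr_ge0 ?sqr_ge0//; lra.
have h2 : 0 <= (1 - 3 * e * u) * u ^+ 2 by rewrite mulr_ge0 ?sqr_ge0//; lra.
have h3 : 0 <= (1 - 3 * e * u) * (u * t) by rewrite mulr_ge0 ?mulr_ge0//; lra.
have h4 : 0 <= e * u * t ^+ 2 by rewrite mulr_ge0 ?sqr_ge0 ?mulr_ge0//; lra.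
have h5 := sqr_ge0 t; have h6 := sqr_ge0 u.
have h7 : 0 <= u * t by rewrite mulr_ge0//; lra.
lra.
Qed.

(** As a function of [u >= 1 / (3 e)] the real part at [(- u, t)] is concave, and
    it is positive at [s = 1 / (3 e)]. *)
Lemma reQ_concave s u' u t : 3 * e * s = 1 -> s <= u' -> u' <= u -> s < u ->
  0 <= reQ (- u) t -> 0 <= reQ (- u') t.
Proof.
hyps; move=> es su' u'u su; rewrite /Re_cubic => gu.
have s0 : 0 < s by rewrite -(pmulr_rgt0 _ e0); lra.
have us : 0 < u - s by rewrite subr_gt0.
have gs : 0 <= e * (3 * s * t ^+ 2 - s ^+ 3) + s ^+ 2 - t ^+ 2 + E.
  have -> : e * (3 * s * t ^+ 2 - s ^+ 3) = (3 * e * s) * t ^+ 2 - (3 * e * s) * s ^+ 2 / 3 by field.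
  by rewrite es; have := sqr_ge0 s; lra.
rewrite -(pmulr_rge0 _ us).
have h1 : 0 <= (u - u') * (e * (3 * s * t ^+ 2 - s ^+ 3) + s ^+ 2 - t ^+ 2 + E).
  by rewrite mulr_ge0// subr_ge0.
have h2 : 0 <= (u' - s) * (e * ((- u) ^+ 3 - 3 * - u * t ^+ 2) + (- u) ^+ 2 - t ^+ 2 + E).
  by rewrite mulr_ge0// subr_ge0.
have h3 : 0 <= (u - s) * (u' - s) * (u - u') * (e * (s + u' + u) - 1).
  apply: mulr_ge0; first by rewrite !mulr_ge0// ?subr_ge0// ltW.
  have : e * (s + s + s) <= e * (s + u' + u) by rewrite ler_pM2l//; lra.
  lra.
lra.
Qed.

Lemma wedge u t : 1 < 3 * e * u -> reQ (- u) t < 0 -> 1 < e * u /\ 3 * t ^+ 2 <= u ^+ 2.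
Proof.
hyps; rewrite /Re_cubic => eu H.
have u0 : 0 < u by rewrite -(pmulr_rgt0 _ e0); lra.
have u2 : 0 < u ^+ 2 by rewrite exprn_gt0.
have H' : (3 * e * u - 1) * t ^+ 2 < (e * u - 1) * u ^+ 2 by lra.
have h1 : 0 <= (3 * e * u - 1) * t ^+ 2 by rewrite mulr_ge0 ?sqr_ge0//; lra.
have eu1 : 1 < e * u by rewrite -subr_gt0 -(pmulr_lgt0 _ u2); lra.
split => //; have p : 0 < 3 * e * u - 1 by lra.
rewrite -(ler_pM2l p); lra.
Qed.

Lemma imQ_left_ge0 u u' t : 1 < e * u -> 3 * t ^+ 2 <= u ^+ 2 -> 0 <= t -> 0 < u -> u <= u' ->
  0 <= imQ (- u') t.
Proof.
hyps; move=> eu tu t0 u0 uu'; rewrite /Im_cubic.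
have -> : e * (3 * (- u') ^+ 2 * t - t ^+ 3) + 2 * - u' * t =
   t * (e * (3 * u' ^+ 2 - t ^+ 2) - 2 * u') by ring.
rewrite mulr_ge0//.
have u2 : u ^+ 2 <= u' ^+ 2 by rewrite lerXn2r ?nnegrE//; lra.
have eu' : e * u <= e * u' by rewrite ler_pM2l.
have h1 : 0 <= e * (u' ^+ 2 - 3 * t ^+ 2) by apply: mulr_ge0; [exact: ltW|lra].
have h2 : 0 <= (e * u' - 1) * u' by rewrite mulr_ge0//; lra.
lra.
Qed.

Lemma reQ_far_le0 (N tau : R) : 3 <= e * N -> 0 <= tau -> tau <= N -> reQ (- (2 * N)) tau <= 0.
Proof.
hyps; move=> eN t0 tN; rewrite /Re_cubic.
have N3 : 3 <= N.
  have N0 : 0 <= N by lra.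
  by apply: le_trans eN _; rewrite ler_piMl.
have t2 : tau ^+ 2 <= N ^+ 2 by rewrite lerXn2r ?nnegrE//; lra.
have eN0 : 0 <= e * N by lra.
have h1 : 0 <= e * N * (N ^+ 2 - tau ^+ 2) by rewrite mulr_ge0//; lra.
have h2 : 0 <= (e * N - 3) * N ^+ 2 by rewrite mulr_ge0 ?sqr_ge0//; lra.
have h3 : 9 <= N ^+ 2 by nra.
have h4 := sqr_ge0 tau.
lra.
Qed.

Lemma reQ_vertical u t tau : 1 < 3 * e * u -> - t <= tau -> tau <= t -> reQ (- u) t < 0 ->
  reQ (- u) tau < 0.
Proof.
hyps; move=> eu t1 t2 H; apply: le_lt_trans H; rewrite /Re_cubic.
have : tau ^+ 2 <= t ^+ 2 by nra.
move=> h; have : 0 <= (3 * e * u - 1) * (t ^+ 2 - tau ^+ 2) by rewrite mulr_ge0//; lra.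
lra.
Qed.

Lemma imQ_ge0 x t : 0 <= t -> t <= x -> 0 <= imQ x t.
Proof.
hyps; move=> t0 tx; rewrite /Im_cubic.
have -> : e * (3 * x ^+ 2 * t - t ^+ 3) + 2 * x * t = t * (e * (3 * x ^+ 2 - t ^+ 2) + 2 * x) by ring.
rewrite mulr_ge0// addr_ge0//; last by lra.
apply: mulr_ge0; [exact: ltW|nra].
Qed.

(** For the pure cubic this holds up to a slope of about 0.71, so that 2/3 is an
    admissible border with [reQ_le0]. *)
Lemma growth_ge0 x t : 0 <= t -> 3 * t <= 2 * x -> 0 <= 24 * reQ x t + 7 * imQ x t.
Proof.
hyps; move=> t0 tx; rewrite /Re_cubic /Im_cubic; have x0 : 0 <= x by lra.
have h1 : 0 <= t * x * (2 * x - 3 * t) by rewrite !mulr_ge0//; lra.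
have h2 : 0 <= x ^+ 2 * (2 * x - 3 * t) by rewrite mulr_ge0 ?sqr_ge0//; lra.
have h3 : 0 <= t ^+ 2 * (2 * x - 3 * t) by rewrite mulr_ge0 ?sqr_ge0//; lra.
have c3 : 0 <= 24 * x ^+ 3 - 72 * x * t ^+ 2 + 21 * x ^+ 2 * t - 7 * t ^+ 3.
  have := exprn_ge0 3 t0; lra.
have h4 : 0 <= e * (24 * x ^+ 3 - 72 * x * t ^+ 2 + 21 * x ^+ 2 * t - 7 * t ^+ 3).
  by rewrite mulr_ge0// ltW.
have h5 : t ^+ 2 <= x ^+ 2 by nra.
have h6 : 0 <= x * t by rewrite mulr_ge0.
lra.
Qed.

End Steps.

(** * Location of the non-real zeros *)

Section Zeros.
Context {R : realType}.
Implicit Types (x t p q u v : R).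
Variables (e E : R) (e0 : 0 < e) (e1 : e <= 1) (E0 : 0 <= E) (E1 : E <= 7 / 4).
Variables (a b : R) (ab0 : (a, b) != (0, 0)) (rec : recessive e E a b).

Local Notation y := (sol e E a%:C b%:C).
Local Notation y1 := (sol' e E a%:C b%:C).
Ltac hyps := move: (e0) (e1) (E0) (E1) => e_gt0 e_le1 E_ge0 E_le.

Let e2 : `|e| <= 2. Proof. by hyps; rewrite gtr0_norm//; lra. Qed.
Let E2 : `|E| <= 2. Proof. by hyps; rewrite ger0_norm//; lra. Qed.

Lemma sqr_lt_neq x x' : x = x' -> x ^+ 2 < x' ^+ 2 -> False.
Proof. by move=> ->; rewrite ltxx. Qed.

Lemma opp2_ge0 x : x <= 0 -> 0 <= - (2 * x).
Proof. by move=> h; lra. Qed.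

Lemma opp2_gt0 x : x < 0 -> 0 < - (2 * x).
Proof. by move=> h; lra. Qed.

Lemma data_neq0 : (a%:C, b%:C) != (0, 0) :> R[i] * R[i].
Proof.
by apply: contra ab0; rewrite !xpair_eqE !eq_complex /= !eqxx !andbT.
Qed.

Lemma flux_axis_le0 u v t : 0 <= u -> 0 <= v -> 2 <= t -> flux y y1 (u +i* v) (0 +i* t) <= 0.
Proof.
move=> u0 v0 t2; rewrite flux_lin; have [h1 h2] := rec.
have t0 : 0 <= t by apply: le_trans t2.
by have := mulr_ge0_le0 u0 (h1 t t0); have := mulr_ge0_le0 v0 (h2 t t2); lra.
Qed.

Lemma conj_pt x t : (x +i* t)^* = x -i* t :> R[i]. Proof. by []. Qed.

Lemma sol_mirror x t : y (x -i* t) = (y (x +i* t))^*.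
Proof. by rewrite -conj_pt sol_conj. Qed.

Lemma sol'_mirror x t : y1 (x -i* t) = (y1 (x +i* t))^*.
Proof. by rewrite -conj_pt sol'_conj. Qed.

Lemma Im_sol_real x : complex.Im (y (x +i* 0)) = 0.
Proof.
have := sol_mirror x 0; rewrite oppr0; case: (y _) => ? ? [] /=; lra.
Qed.

Lemma Im_sol'_real x : complex.Im (y1 (x +i* 0)) = 0.
Proof.
have := sol'_mirror x 0; rewrite oppr0; case: (y1 _) => ? ? [] /=; lra.
Qed.

Lemma flux_i_real x : flux y y1 'i (x +i* 0) = 0.
Proof.
rewrite /flux; have := Im_sol_real x; have := Im_sol'_real x.
by case: (y _) (y1 _) => [? ?] [? ?] /= -> ->; ring.
Qed.

(** The multiplier is minus the conjugate of the direction of the path, so that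
    [Om d < 0] and only the sign of the real part of the cubic matters. *)
Lemma no_zero_steep x t : 0 <= x -> 2 * x <= 3 * t -> 3 + 2 * e <= e * t ->
  y (x +i* t) <> 0.
Proof.
hyps; move=> x0 xt et.
have t2 : 2 <= t by rewrite -(ler_pM2l e_gt0); lra.
apply: (@no_zero_step _ e E e0 e1 E0 E1 a%:C b%:C x t (- x) (2 * x + 1) x (2 * x + 1)
  0 (t + (2 * x + 1)) data_neq0 (subrr x) erefl); [nra| |by apply: flux_axis_le0; lra].
move=> r r0 r1.
have rx : r * x <= x by rewrite ler_piMl.
have rx0 : 0 <= r * x by rewrite mulr_ge0.
have : Re_cubic e E (x + r * - x) (t + r * (2 * x + 1)) <= 0.
  apply: (reQ_le0 e0 e1 E0 E1); [lra|lra|].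
  by apply: le_trans et _; rewrite ler_pM2l//; lra.
move: (Re_cubic _ _ _ _) (Im_cubic _ _ _) => g h g0.
have -> : (x * - x - (2 * x + 1) * (2 * x + 1)) * g - (x * (2 * x + 1) + (2 * x + 1) * - x) * h =
  (x ^+ 2 + (2 * x + 1) ^+ 2) * - g by ring.
by rewrite mulr_ge0 ?addr_ge0 ?sqr_ge0// oppr_ge0.
Qed.

(** Either [y y' > 0] at some point [c] of the positive axis, hence beyond [c],
    and paths that start there reach the whole wedge with a positive flux; or
    [y y' <= 0] on the whole half-axis, and descending paths from a zero end
    there. *)
Lemma no_zero_flat : exists2 c : R, 0 <= c & forall x t, 0 < t -> 3 * t <= 2 * x -> c <= x ->
  y (x +i* t) <> 0.
Proof.
hyps; have [[c [c0 fc]]|noc] := pselect (exists c : R, 0 <= c /\ 0 < flux y y1 1 (c +i* 0)).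
- have {}fc c' : c <= c' -> 0 < flux y y1 1 (c' +i* 0).
    move=> cc'; apply: lt_le_trans fc _.
    apply: (@step_le _ e E e0 e1 E0 E1 a%:C b%:C c 0 (c' - c) 0 1 0 c' 0) => [|||r r0 r1];
      [by rewrite addrC subrK|by rewrite addr0|by lra|].
    rewrite !mul0r mulr0 addr0 mul1r subr0 mulr0 addr0 mul0r subr0 mulr_ge0 ?subr_ge0//.
    have : 0 <= c + r * (c' - c) by rewrite addr_ge0// mulr_ge0// subr_ge0.
    move: (c + _) => z z0; rewrite /Re_cubic expr0n /= mulr0 !subr0 addr_ge0// addr_ge0 ?sqr_ge0//.
    by rewrite mulr_ge0 ?exprn_ge0// ltW.
  (* The path has direction [4 + 3 i] and multiplier [3 - 4 i], for which the term
     in [|y'|^2] disappears; it starts at [x - 4 t / 3 >= x / 9]. *)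
  exists (9 * c) => [|x t t0 tx cx yz]; first by lra.
  have := @step_le _ e E e0 e1 E0 E1 a%:C b%:C (x - 4 / 3 * t) 0 (4 / 3 * t) t 3 (-4) x t
    (subrK _ _) (add0r t).
  rewrite (flux0 _ _ yz) flux_lin flux_i_real mulr0 addr0.
  suff H : 0 < 3 * flux y y1 1 ((x - 4 / 3 * t) +i* 0).
    move=> h; move: H; rewrite ltNge => /negP; apply; apply: h; first by lra.
    move=> r r0 r1; rewrite !add0r.
    have rt0 : 0 <= r * t by rewrite mulr_ge0// ltW.
    have : 0 <= 24 * Re_cubic e E (x - 4 / 3 * t + r * (4 / 3 * t)) (r * t) +
        7 * Im_cubic e (x - 4 / 3 * t + r * (4 / 3 * t)) (r * t).
      apply: (growth_ge0 e0 e1 E0 E1) => //.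
      have : 0 <= (1 - r) * (x - 4 / 3 * t) by rewrite mulr_ge0//; lra.
      have : 0 <= r * (2 * x - 3 * t) by rewrite mulr_ge0//; lra.
      lra.
    move: (Re_cubic _ _ _ _) (Im_cubic _ _ _) => g h gh.
    have -> : (3 * (4 / 3 * t) - -4 * t) * g - (3 * t + -4 * (4 / 3 * t)) * h =
      t / 3 * (24 * g + 7 * h) by field.
    by rewrite mulr_ge0//; lra.
  by rewrite mulr_gt0// fc//; lra.
- exists 0 => // x t t0 tx _.
  have f1 c : 0 <= c -> flux y y1 1 (c +i* 0) <= 0.
    by move=> c0; rewrite leNgt; apply/negP => f; apply: noc; exists c.
  have descending r : 0 <= r -> r <= 1 ->
      0 <= (1 * t - -1 * - t) * Re_cubic e E (x + r * t) (t + r * - t) -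
           (1 * - t + -1 * t) * Im_cubic e (x + r * t) (t + r * - t).
    move=> r0 r1.
    have rt : r * t <= t by rewrite ler_piMl// ltW.
    have rt0 : 0 <= r * t by rewrite mulr_ge0// ltW.
    have : 0 <= Im_cubic e (x + r * t) (t + r * - t) by apply: (imQ_ge0 e0 e1 E0 E1); lra.
    move: (Re_cubic _ _ _ _) (Im_cubic _ _ _) => g h h0.
    have := mulr_ge0 (ltW t0) h0; lra.
  apply: (@no_zero_step _ e E e0 e1 E0 E1 a%:C b%:C x t t (- t) 1 (-1) (x + t) 0 data_neq0
    erefl (subrr t)); first by lra.
    move=> r r0 r1; exact: descending.
  by rewrite flux_lin flux_i_real mulr0 addr0 mul1r f1//; lra.
Qed.

(** High up near the imaginary axis the real part of the cubic is negative; the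
    diagonal direction takes advantage of the imaginary part, about [- e t^3]. *)
Lemma flux_strip u t : 0 <= u -> 3 * e * u <= 1 -> 3 + 2 * e <= e * t ->
  flux y y1 1 (- u +i* t) <= 0 /\ (0 < u -> y (- u +i* t) <> 0).
Proof.
hyps; move=> u0 eu et.
have t2 : 2 <= t by rewrite -(ler_pM2l e_gt0); lra.
have H r : 0 <= r -> r <= 1 -> 0 <= (1 * u - 0 * u) * Re_cubic e E (- u + r * u) (t + r * u) -
    (1 * u + 0 * u) * Im_cubic e (- u + r * u) (t + r * u).
  move=> r0 r1.
  have ru : r * u <= u by rewrite ler_piMl.
  have ru0 : 0 <= r * u by rewrite mulr_ge0.
  have := @diag_ge0 _ e E e0 e1 E0 E1 (u - r * u) (t + r * u).
  rewrite opprB [r * u - u]addrC => /(_ _ _ _)/(mulr_ge0 u0) h.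
  have {}h : 0 <= u * (Re_cubic e E (- u + r * u) (t + r * u) - Im_cubic e (- u + r * u) (t + r * u)).
    apply: h; first by lra.
      by apply: le_trans eu; rewrite ler_pM2l ?mulr_gt0//; lra.
    apply: le_trans (_ : e * t <= _); first by lra.
    by rewrite ler_pM2l//; lra.
  by rewrite !mul1r !mul0r subr0 addr0 -mulrBr.
have axis : flux y y1 1 (0 +i* (t + u)) <= 0.
  by apply: (@flux_axis_le0 1 0) => //; lra.
split.
  apply: le_trans axis.
  by apply: (@step_le _ e E e0 e1 E0 E1 a%:C b%:C (- u) t u u 1 0 0 (t + u) (addNr u) erefl _ H); lra.
move=> u_gt0.
by apply: (@no_zero_step _ e E e0 e1 E0 E1 a%:C b%:C (- u) t u u 1 0 0 (t + u) data_neq0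
  (addNr u) erefl _ H axis); lra.
Qed.

(** The path is horizontal up to the abscissa [- 1 / (3 e)], beyond which the
    real part of the cubic may change sign, and then diagonal. *)
Lemma no_zero_left u t : 1 < 3 * e * u -> 0 <= Re_cubic e E (- u) t -> 3 + 2 * e <= e * t ->
  y (- u +i* t) <> 0.
Proof.
hyps; move=> eu gu et.
pose s := (3 * e)^-1.
have e3 : 3 * e != 0 by rewrite mulf_neq0 ?pnatr_eq0// gt_eqF.
have es : 3 * e * s = 1 by rewrite /s divff.
have s0 : 0 < s by rewrite invr_gt0 mulr_gt0.
have su : s < u by rewrite -(ltr_pM2l (_ : 0 < 3 * e)) ?mulr_gt0// es.
have es1 : 3 * e * s <= 1 by rewrite es.
have [fs _] := flux_strip (ltW s0) es1 et.
apply: (@no_zero_step _ e E e0 e1 E0 E1 a%:C b%:C (- u) t (u - s) 0 1 0 (- s) t data_neq0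
  (addKr u (- s)) (addr0 t) _ _ fs); first by lra.
move=> r r0 r1; rewrite !mulr0 addr0 !mul1r !mul0r addr0 mul0r !subr0.
apply: mulr_ge0; first by rewrite subr_ge0 ltW.
have h1 : 0 <= r * (u - s) by rewrite mulr_ge0// subr_ge0 ltW.
have h2 : 0 <= (1 - r) * (u - s) by rewrite mulr_ge0// subr_ge0// ltW.
have := @reQ_concave _ e E e0 e1 E0 E1 s (u - r * (u - s)) u t es.
by rewrite opprB [r * _ - u]addrC; apply => //; lra.
Qed.

(** Let [phi] vanish at [- 2 N + i N]. On the path that runs from the zero
    horizontally to the left and then vertically up to that point, the flux of
    [phi] increases to 0; on the vertical segment between the zero and its
    conjugate [|phi|^2] is convex, hence decreasing, in contradiction to
    [modulus_at_zeros]. *)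
Lemma no_zero_wedge u t : 0 < t -> 1 < 3 * e * u -> Re_cubic e E (- u) t < 0 -> y (- u +i* t) <> 0.
Proof.
hyps; move=> t0 eu gu yz.
have [eu1 tu] := wedge e0 e1 E0 E1 eu gu.
have u0 : 0 < u by rewrite -(pmulr_rgt0 _ e_gt0); lra.
have ltNt : - t < t by lra.
pose N := u + t + 3 / e.
have e3 : 0 < 3 / e by rewrite divr_gt0.
have eN : 3 <= e * N.
  have -> : e * N = e * (u + t) + 3 by rewrite /N mulrDr [e * (3 / e)]mulrC divfK// gt_eqF.
  by rewrite lerDr mulr_ge0//; lra.
pose pN : R[i] := (- (2 * N)) +i* N.
have phiN := sol_vanishing e2 E2 pN; have := vanishing_data_neq0 e2 E2 pN.
move: phiN; case: (vanishing_data e E pN) => A B /= phiN AB0.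
set phi := sol e E A B in phiN; set phi1 := sol' e E A B.
have top : flux phi phi1 'i (- u +i* t) <= 0.
  suff : flux phi phi1 'i (- u +i* t) <= flux phi phi1 'i pN by rewrite [leRHS]flux0.
  apply: le_trans (_ : _ <= flux phi phi1 'i ((- (2 * N)) +i* t)) _.
    apply: (@step_le _ e E e0 e1 E0 E1 A B (- u) t (u - 2 * N) 0 0 1 (- (2 * N)) t
      (addKr u _) (addr0 t)) => [|r r0 r1]; first by lra.
    rewrite !mulr0 addr0 !mul0r subr0 mul0r sub0r add0r mul1r -mulNr.
    rewrite mulr_ge0//; first by rewrite /N; lra.
    have := @imQ_left_ge0 _ e E e0 e1 E0 E1 u (u - r * (u - 2 * N)) t eu1 tu (ltW t0) u0.
    rewrite opprB [r * _ - u]addrC; apply.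
    have : 0 <= r * (2 * N - u) by rewrite mulr_ge0// /N; lra.
    lra.
  apply: (@step_le _ e E e0 e1 E0 E1 A B (- (2 * N)) t 0 (N - t) 0 1 (- (2 * N)) N
    (addr0 _) (subrKC t N)) => [|r r0 r1]; first by rewrite /N; lra.
  have h1 : 0 <= r * (N - t) by rewrite mulr_ge0// /N; lra.
  have h2 : 0 <= (1 - r) * (N - t) by rewrite mulr_ge0//; rewrite /N; lra.
  have : Re_cubic e E (- (2 * N)) (t + r * (N - t)) <= 0.
    by apply: (reQ_far_le0 e0 e1 E0 E1 eN); lra.
  rewrite !mulr0 !addr0; move: (Re_cubic _ _ _ _) (Im_cubic _ _ _) => g h g0.
  have : 0 <= (N - t) * - g by rewrite mulr_ge0 ?oppr_ge0// /N; lra.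
  lra.
have neg tau : - t <= tau -> tau <= t -> Re_cubic e E (- u) tau < 0.
  by move=> h1 h2; exact: (reQ_vertical e0 e1 E0 E1 eu h1 h2 gu).
have seg s s' : - t <= s -> s <= s' -> s' <= t -> forall r, 0 <= r -> r <= 1 ->
     0 <= (0 * 0 - 1 * (s' - s)) * Re_cubic e E (- u + r * 0) (s + r * (s' - s)) -
      (0 * (s' - s) + 1 * 0) * Im_cubic e (- u + r * 0) (s + r * (s' - s)).
  move=> ts ss s't r r0 r1; rewrite !mulr0 !addr0.
  have h1 : 0 <= r * (s' - s) by rewrite mulr_ge0// subr_ge0.
  have h2 : 0 <= (1 - r) * (s' - s) by rewrite mulr_ge0// subr_ge0.
  have : Re_cubic e E (- u) (s + r * (s' - s)) < 0 by apply: neg; lra.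
  move: (Re_cubic _ _ _ _) (Im_cubic _ _ _) => g h g0.
  have : 0 <= (s' - s) * - g by rewrite mulr_ge0 ?oppr_ge0 ?subr_ge0// ltW.
  lra.
have fle s : - t <= s -> s <= t -> flux phi phi1 'i (- u +i* s) <= 0.
  move=> ts st; apply: le_trans top.
  apply: (@step_le _ e E e0 e1 E0 E1 A B (- u) s 0 (t - s) 0 1 (- u) t (addr0 _) (subrKC s t)).
    by lra.
  by apply: seg.
have flt : flux phi phi1 'i (- u +i* (- t)) < 0.
  apply: lt_le_trans top.
  apply: (@step_lt _ e E e0 e1 E0 E1 A B (- u) (- t) 0 (t - - t) 0 1 (- u) t (addr0 _)
    (subrKC (- t) t)); first by lra.
    by apply: seg; lra.
  have negt : 0 < - Re_cubic e E (- u) (- t) by rewrite oppr_gt0 neg// ltW.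
  rewrite -/phi -/phi1; move: (Re_cubic e E _ _) (Im_cubic e _ _) negt => g h g0.
  have -> : (0 * 0 - 1 * (t - - t)) * g - (0 * (t - - t) + 1 * 0) * h = (t + t) * - g by ring.
  have -> : 0 * 0 + 1 * (t - - t) = t + t by ring.
  have tt : 0 < t + t by rewrite addr_gt0.
  have sq0 z : 0 <= cabs z ^+ 2 by rewrite exprn_ge0 ?cabs_ge0.
  have sqp z : z != 0 -> 0 < cabs z ^+ 2.
    by move=> zn; rewrite exprn_gt0// lt_def cabs_ge0 cabs_eq0 zn.
  have [p0|p1] := eqVneq (phi1 (- u -i* t)) 0; last first.
    by apply: ltr_wpDr; [exact: (mulr_ge0 (mulr_ge0 (ltW tt) (ltW g0)) (sq0 _ _))|
      exact: (mulr_gt0 tt (sqp _ _ p1))].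
  apply: ltr_wpDl; first exact: (mulr_ge0 (ltW tt) (sq0 _ _)).
  apply: (mulr_gt0 (mulr_gt0 tt g0) (sqp _ _ _)); apply/eqP => pz.
  by have := sol_simple_zero e2 E2 AB0 pz; rewrite -/phi1 p0 eqxx.
have phid : cderiv phi phi1 by exact: sol_cderiv.
have decr : cabs (phi (- u +i* t)) ^+ 2 < cabs (phi (- u -i* t)) ^+ 2.
  rewrite -ltrN2.
  apply: (@is_derive_increasing _ (fun s => - cabs (phi (- u +i* s)) ^+ 2)
    (fun s => - (2 * flux phi phi1 'i (- u +i* s))) _ _ ltNt).
  - by move=> s _ _; apply: is_deriveN; exact: cabs2_derive_vertical.
  - by move=> s h1 h2; exact: (opp2_ge0 (fle s h1 h2)).
  - exact: (opp2_gt0 flt).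
have yz' : y (- u -i* t) = 0 by rewrite sol_mirror yz conjc0.
have y1c : cabs (y1 (- u -i* t)) = cabs (y1 (- u +i* t)) by rewrite sol'_mirror; exact: cabs_conj.
have h := modulus_at_zeros (sol_ode e2 E2 a%:C b%:C) (sol_ode e2 E2 A B) yz yz'
  (sol_simple_zero e2 E2 data_neq0 yz) y1c.
exact: (sqr_lt_neq h decr).
Qed.

Lemma nonreal_zeros_bounded : exists X : R, forall x t, t != 0 -> y (x +i* t) = 0 ->
  `|x| <= X /\ `|t| <= X.
Proof.
hyps; have [c c0 flat] := no_zero_flat.
pose T := 3 / e + 2; pose U := 3 * T ^+ 2 + 3 / e + 1.
have e3 : 0 < 3 / e by rewrite divr_gt0.
have eT : e * T = 3 + 2 * e by rewrite /T mulrDr [e * (3 / e)]mulrC divfK ?gt_eqF//; lra.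
have T0 : 0 < T by rewrite /T; lra.
have U0 : 0 < U by rewrite /U; have := sqr_ge0 T; lra.
pose X := c + 2 * T + U.
have main x t : 0 < t -> y (x +i* t) = 0 -> `|x| <= X /\ `|t| <= X.
  move=> t0 yz; rewrite (gtr0_norm t0).
  have small : e * t < 3 + 2 * e -> t < T by rewrite -eT ltr_pM2l.
  have [x0|x0] := leP 0 x.
    rewrite ger0_norm//.
    have [xt|xt] := leP (2 * x) (3 * t).
      have [/(no_zero_steep x0 xt)//|/small tT] := leP (3 + 2 * e) (e * t).
      by rewrite /X; split; lra.
    have [cx|cx] := leP c x; first by case: (flat x t t0 (ltW xt) cx).
    by rewrite /X; split; lra.
  have [u ux] : exists u, x = - u by exists (- x); rewrite opprK.
  rewrite ux normrN in yz *; have u0 : 0 < u by move: x0; rewrite ux; lra.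
  rewrite gtr0_norm//.
  have [eu|eu] := leP (3 * e * u) 1.
    have tT : t < T.
      apply: small; rewrite ltNge; apply/negP => et.
      by have [_ /(_ u0)] := flux_strip (ltW u0) eu et.
    have : u <= 3 / e by rewrite ler_pdivlMr//; lra.
    by rewrite /X /U; have := sqr_ge0 T; split; lra.
  have [gu|gu] := leP 0 (Re_cubic e E (- u) t); last by case: (no_zero_wedge t0 eu gu).
  have tT : t < T.
    by apply: small; rewrite ltNge; apply/negP => et; case: (no_zero_left eu gu et).
  have uU : u <= U.
    rewrite leNgt; apply/negP => uU; move: gu; apply/negP; rewrite -ltNge /Re_cubic.
    have t2 : t ^+ 2 <= T ^+ 2 by rewrite lerXn2r ?nnegrE ?ltW.
    have u1 : 1 <= u by move: uU; rewrite /U; have := sqr_ge0 T; lra.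
    have h1 : 0 <= e * u * (T ^+ 2 - t ^+ 2).
      by apply: mulr_ge0; [apply: mulr_ge0; exact: ltW|rewrite subr_ge0].
    have eu3 : 3 * e * T ^+ 2 + 3 <= e * u.
      have -> : 3 * e * T ^+ 2 + 3 = e * (3 * T ^+ 2 + 3 / e).
        by rewrite mulrDr [e * (3 / e)]mulrC divfK ?gt_eqF//; ring.
      by rewrite ler_pM2l//; move: uU; rewrite /U; lra.
    have h2 : 0 <= (e * u - 3 * e * T ^+ 2 - 3) * u ^+ 2 by rewrite mulr_ge0 ?sqr_ge0//; lra.
    have h3 : 0 <= e * T ^+ 2 * u * (u - 1).
      apply: mulr_ge0; last by rewrite subr_ge0.
      by apply: mulr_ge0; [apply: mulr_ge0; [exact: ltW|exact: sqr_ge0]|exact: ltW].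
    have h4 : 1 <= u ^+ 2 by rewrite exprn_ege1.
    have h5 : 0 < t ^+ 2 by rewrite exprn_gt0.
    lra.
  by rewrite /X; split; lra.
exists X => x t tn yz.
have [t0|t0] := ltP 0 t; first exact: main.
have := main x (- t); rewrite normrN; apply; first by rewrite oppr_gt0 lt_neqAle tn.
by rewrite sol_mirror yz conjc0.
Qed.

End Zeros.

(** * The sets of zeros *)

Lemma infinite_injection (T : Type) (A : set T) : infinite_set A ->
  exists2 f : nat -> T, injective f & forall n, A (f n).
Proof.
move=> /infiniteP/card_leP[f].
pose sub n : set_type [set: nat] := SigSub (mem_set (I : [set: nat] n)).
exists (fun n => set_val (f (sub n))) => [n m|n]; last exact: set_valP.
move=> /val_inj fnm; have := @inj _ _ _ f (sub n) (sub m).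
by rewrite !in_setT => /(_ isT isT fnm) /(congr1 val).
Qed.

(** Conjugation exchanges the elements above and below the real axis. *)
Lemma even_card_conj (R : realType) (A : {fset R[i]}) : (forall z, z \in A -> complex.Im z != 0) ->
  (forall z, z \in A -> z^* \in A) -> ~~ odd #|` A|.
Proof.
move=> Im0 Aconj.
pose Up := [fset z in A | 0 < complex.Im z]%fset.
have UpA : (Up `<=` A)%fset by apply/fsubsetP => z; rewrite !inE => /andP[].
have -> : #|` A| = (#|` Up| + #|` (A `\` Up)%fset|)%N by rewrite -(cardfsID Up A) (fsetIidPr UpA).
have -> : (A `\` Up)%fset = [fset z^* | z in Up]%fset.
  apply/fsetP => z; apply/idP/imfsetP => /=.
    rewrite !inE => /andP[h zA]; exists (z^*); rewrite ?conjcK//.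
    rewrite !inE Aconj//=; move: h (Im0 z zA); rewrite zA /=.
    by case: z {zA} => x t /=; rewrite -leNgt oppr_gt0 lt_neqAle => -> ->.
  move=> [w]; rewrite !inE => /andP[wA w0] ->; rewrite Aconj// andbT /=.
  by case: w {wA} w0 => x t /= t0; rewrite oppr_gt0 ltNge ltW.
have -> : #|` [fset z^* | z in Up]%fset| = #|` Up|.
  by rewrite [LHS]card_imfset//= => -[? ?] [? ?] [-> ?]; congr Complex; lra.
by rewrite addnn odd_double.
Qed.

Section ZeroSets.
Context {R : realType}.
Implicit Types (x t : R).

Section Fixed.
Variables (e E : R) (e0 : 0 < e) (e1 : e <= 1) (E0 : 0 <= E) (E1 : E <= 7 / 4).

Let e2 : `|e| <= 2. Proof. by move: (e0) (e1) => ? ?; rewrite gtr0_norm//; lra. Qed.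
Let E2 : `|E| <= 2. Proof. by move: (E0) (E1) => ? ?; rewrite ger0_norm//; lra. Qed.

(** A limit point of zeros would be a multiple zero. *)
Lemma discrete_zeros (a b : R[i]) (Z : set R[i]) (X : R) : (a, b) != (0, 0) ->
  (forall z, Z z -> sol e E a b z = 0 /\ cabs z <= X) -> finite_set Z.
Proof.
move=> ab0 HZ; apply: contrapT => /infinite_injection[f finj fZ].
have [U [UU Uoo]] := ultraFilterLemma eventually_filter.
have UF : ProperFilter U := @ultra_proper _ _ UU.
have [l fl] := ultra_cbounded (u := f) (fun n => (HZ _ (fZ n)).2).
have small (c B : R) : 0 <= B ->
    (forall n, f n != l -> cabs (f n - l) <= 1 -> c <= B * cabs (f n - l)) -> c <= 0.
  move=> B0 H; rewrite leNgt; apply/negP => c0.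
  have d0 : 0 < Num.min 1 (c / (B + 1)) by rewrite lt_min ltr01 divr_gt0//; lra.
  have ne : \forall n \near U, f n != l.
    have [[m fm]|nom] := pselect (exists m, f m = l); last first.
      by apply: nearW => n; apply/eqP => fn; apply: nom; exists n.
    apply: Uoo; exists m.+1 => // n /= mn; apply/eqP => fn.
    have /finj nm : f n = f m by rewrite fn fm.
    by rewrite nm ltnn in mn.
  have [n [fn]] := filter_ex (filterI ne (fl _ d0)).
  rewrite lt_min => /andP[n1 n2]; have := H n fn (ltW n1); apply/negP; rewrite -ltNge.
  apply: le_lt_trans (_ : (B + 1) * cabs (f n - l) < c); last by rewrite mulrC -ltr_pdivlMr//; lra.
  by rewrite ler_wpM2r ?cabs_ge0//; lra.
have [B B0 HB] := cderiv_cont l (sol_cderiv a b e2 E2).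
have [B' B'0 HB'] := sol_cderiv a b e2 E2 l.
have yl : sol e E a b l = 0.
  apply/eqP; rewrite -cabs_eq0 eq_le cabs_ge0 andbT; apply: (small _ B B0) => n _ n1.
  have := HB (f n - l) n1; rewrite subrKC (HZ _ (fZ n)).1 sub0r cabsN; exact.
have /eqP := sol_simple_zero e2 E2 ab0 yl; apply.
apply/eqP; rewrite -cabs_eq0 eq_le cabs_ge0 andbT; apply: (small _ B' B'0) => n fn n1.
have h0 : 0 < cabs (f n - l) by rewrite lt_def cabs_ge0 cabs_eq0 subr_eq0 fn.
have := HB' (f n - l) n1; rewrite subrKC (HZ _ (fZ n)).1 yl subrr sub0r cabsN cabsM => h.
by rewrite -(ler_pM2l h0) mulrCA -expr2.
Qed.

Section Real.
Variables (a b : R) (ab0 : (a, b) != (0, 0)).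
Local Notation y := (sol e E a%:C b%:C).
Local Notation y1 := (sol' e E a%:C b%:C).

Lemma Re_derive_left (F F1 : R[i] -> R[i]) (s : R) : cderiv F F1 ->
  is_derive s 1 (fun s => complex.Re (F ((- s) +i* 0))) (- complex.Re (F1 ((- s) +i* 0))).
Proof.
move=> Fd; have [] := is_derive_line 0 (-1) s Fd.
have ax (r : R) : 0 + r%:C * -1 = (- r) +i* 0 :> R[i].
  by apply/eqP; rewrite eq_complex /=; apply/andP; split; apply/eqP; ring.
have -> : (fun s => complex.Re (F (0 + s%:C * -1))) = (fun s => complex.Re (F ((- s) +i* 0))).
  by apply/funext => r; rewrite ax.
by rewrite ax mulN1r; case: (F1 _).
Qed.

(** Far on the negative axis [Q <= -1], and there the logarithmic derivative of
    a solution without zeros would blow up. *)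
Lemma real_zero_left (X : R) : exists2 x, x <= X & y (x +i* 0) = 0.
Proof.
apply: contrapT => noz.
pose S := `|X| + 4 / e.
have SX : - S <= X.
  rewrite /S; have : 0 < 4 / e by rewrite divr_gt0.
  by have := ler_norm (- X); rewrite normrN; lra.
pose g s := complex.Re (y ((- s) +i* 0)).
pose g1 s := complex.Re (y1 ((- s) +i* 0)).
have gn s : S <= s -> g s != 0.
  move=> Ss; apply/eqP => gs; apply: noz; exists (- s); first by lra.
  have := @Im_sol_real _ e E e0 e1 E0 E1 a b (- s).
  by move: gs; rewrite /g; case: (y _) => ? ? /= -> ->.
have gd (s : R) : is_derive s 1 g (- g1 s) := Re_derive_left s (sol_cderiv _ _ e2 E2).
have g1d (s : R) : is_derive s 1 g1 (- (Re_cubic e E (- s) 0 * g s)).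
  have := Re_derive_left s (sol'_cderiv a%:C b%:C e2 E2).
  rewrite cubicE /g; have := @Im_sol_real _ e E e0 e1 E0 E1 a b (- s).
  by case: (y _) => ? ? /= ->; rewrite mulr0 subr0.
have far s : S <= s -> Re_cubic e E (- s) 0 <= - 1.
  move=> Ss; rewrite /Re_cubic.
  have es : 4 <= e * s.
    rewrite mulrC -ler_pdivrMr//; apply: le_trans Ss; rewrite /S lerDr; exact: normr_ge0.
  have s0 : 0 <= s by rewrite -(pmulr_rge0 _ e0); lra.
  have s4 : 4 <= s by apply: le_trans es _; rewrite ler_piMl.
  have h1 : 0 <= (e * s - 4) * s ^+ 2 by rewrite mulr_ge0 ?sqr_ge0//; lra.
  have h2 : 0 <= (s - 4) * (s + 4) by rewrite mulr_ge0//; lra.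
  by move: (E1) => ?; lra.
pose v s := - g1 s / g s; pose dv s := Re_cubic e E (- s) 0 - v s ^+ 2.
apply: (@riccati_blowup _ v dv S) => s Ss.
  have gs := gn s Ss; have := gd s; have := g1d s => ? ?.
  apply: is_derive_eq; rewrite /GRing.scale /= /dv /v.
  by move: (g s) (g1 s) (Re_cubic _ _ _ _) gs => p q r pn; field.
by rewrite /dv; have := far s Ss; lra.
Qed.

Lemma infinite_real_zeros : infinite_set (@real_zeros R[i] y).
Proof.
move=> fin.
have [X HX] : exists X : R, forall z, real_zeros y z -> X <= complex.Re z.
  have /finite_fsetP[s sE] := fin.
  have [X HX] : exists X : R, forall z, z \in s -> X <= complex.Re z.
    exists (- \sum_(z <- s) `|complex.Re z|) => z zs.
    rewrite lerNl (big_fsetD1 z)//=.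
    have := ler_norm (- complex.Re z); rewrite normrN => h; apply: le_trans h _.
    by rewrite lerDl sumr_ge0.
  by exists X => z zZ; apply: HX; have : [set` s] z by rewrite -sE.
have [x xX yx] := real_zero_left (X - 1).
have : X <= x by apply: (HX (x +i* 0)); split => //; rewrite complex_real.
lra.
Qed.

Hypothesis rec : recessive e E a b.

Lemma finite_nonreal_zeros : finite_set (@nonreal_zeros R[i] y).
Proof.
have [X HX] := nonreal_zeros_bounded e0 e1 E0 E1 ab0 rec.
apply: (@discrete_zeros a%:C b%:C _ (X + X)); first exact: data_neq0.
move=> [x t] [nr yz]; split => //.
rewrite complex_real in nr; have [h1 h2] := HX x t nr yz.
by apply: le_trans (cabs_ReIm _) _; rewrite lerD.
Qed.

Lemma nonreal_zeros_conj z : @nonreal_zeros R[i] y z -> @nonreal_zeros R[i] y (Num.conj z).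
Proof.
case: z => x t [nr yz]; split; first by move: nr; rewrite !complex_real oppr_eq0.
by change (y (x -i* t) = 0); rewrite sol_mirror// yz conjc0.
Qed.

Definition oscillator : {poly R[i]} := - (e%:C *: 'X^3 + 'X^2 + (E%:C)%:P).

Lemma size_oscillator : size oscillator = 4%N.
Proof.
have en : e%:C != 0 :> R[i] by rewrite eq_complex /= eqxx andbT gt_eqF.
rewrite /oscillator size_polyN -addrA size_polyDl size_scale// size_polyXn//.
apply: leq_ltn_trans (size_polyD _ _) _; rewrite size_polyXn gtn_max /=.
by rewrite (leq_ltn_trans (size_polyC_leq1 _)).
Qed.

Lemma solution_sol : @solution R[i] oscillator y.
Proof.
have yd := cderiv_has_derivative (sol_cderiv a%:C b%:C e2 E2).
have y1d := cderiv_has_derivative (sol'_cderiv a%:C b%:C e2 E2).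
have y1E : derive1 (y : (R[i] : numClosedFieldType) -> (R[i] : numClosedFieldType)) = y1.
  by apply/funext => z; case: (yd z).
split; first by move=> z; case: (yd z).
  by rewrite y1E => z; case: (y1d z).
move=> z; rewrite derive1nS derive1n1 y1E; case: (y1d z) => _ ->.
by rewrite /oscillator hornerN !hornerD hornerZ !hornerXn hornerC /cubic; ring.
Qed.

Lemma almost_all_real_sol : @almost_all_real_solution R[i] oscillator y.
Proof.
split; [exact: solution_sol| |exact: infinite_real_zeros|exact: finite_nonreal_zeros].
have [X HX] := nonreal_zeros_bounded e0 e1 E0 E1 ab0 rec.
have t0 : 0 < `|X| + 1 by rewrite ltr_wpDl.
exists (0 +i* (`|X| + 1)); apply/eqP => /(HX _ _ (lt0r_neq0 t0))[_].
by rewrite gtr0_norm// leNgt; apply/negP; rewrite negbK (le_lt_trans (ler_norm _))// ltrDl.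
Qed.

Lemma even_nonreal_zeros : ~~ odd #|` fset_set (@nonreal_zeros R[i] y)|.
Proof.
have inZ z : z \in fset_set (@nonreal_zeros R[i] y) <-> @nonreal_zeros R[i] y z.
  by rewrite in_fset_set; [split=> [/set_mem//|/mem_set]|exact: finite_nonreal_zeros].
apply: (@even_card_conj R (fset_set (@nonreal_zeros R[i] y))) => z.
  by move=> /inZ; case: z => x t [nr _]; move: nr; rewrite complex_real.
by move=> /inZ/nonreal_zeros_conj/inZ.
Qed.

End Real.
End Fixed.
End ZeroSets.

(** * The unbounded curve and the theorem *)

Section RealHalfLine.
Context {R : realType}.

Definition real_ray (x0 : R) : set R[i] := (real_complex R) @` [set` `[x0, +oo[ ].

Lemma curve_real_ray x0 : @is_curve R R[i] (real_ray x0).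
Proof.
exists `[x0, +oo[, (real_complex R); split => //.
apply: continuous_subspaceT => x; apply/cvgrPdist_lt => d.
case: d => d1 d2; rewrite ltcE /= => /andP[/eqP-> d0].
apply/nbhs_ballP; exists d1 => // t xt.
by rewrite -rmorphB normcabs cabs_real ltcR.
Qed.

Lemma unbounded_real_ray x0 : @unbounded R[i] (real_ray x0).
Proof.
move=> [M [Mr H]].
have [m Mm] : exists m : R, M = m%:C by apply/complex_realP.
pose t := `|m| + `|x0| + 1.
have tx : real_ray x0 (t + 1)%:C.
  exists (t + 1) => //=; rewrite in_itv /= andbT /t.
  by have := ler_norm x0; have := normr_ge0 m; lra.
have Mt : M < t%:C.
  by rewrite Mm ltcR /t; have := ler_norm m; have := normr_ge0 x0; lra.
have : `|(t + 1)%:C| <= t%:C :> R[i] := H _ Mt _ tx.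
by rewrite normcabs cabs_real lecR; have := ler_norm (t + 1); lra.
Qed.

End RealHalfLine.

Theorem proposition24 (R : realType) :
  exists (Theta : set R[i]) (P : R[i] -> {poly R[i]}),
    [/\ is_curve R Theta,
        unbounded Theta,
        (forall x, Theta x ->
           size (P x) = 4%N /\ exists y, almost_all_real_solution (P x) y)
      & exists2 xcrit, Theta xcrit &
          exists y, [/\ almost_all_real_solution (P xcrit) y,
            ~~ odd #|` fset_set (nonreal_zeros y)|
          & forall z, nonreal_zeros y z -> nonreal_zeros y (Num.conj z)]].
Proof.
have [e0 /andP[e00 e01] ex] := @exists_recessive R.
have {}ex (x : R) : exists E : R, e0^-1 <= x -> exists a b : R,
    [/\ 0 <= E <= 7 / 4, (a, b) != (0, 0) & recessive x^-1 E a b].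
  have [x0|x0] := leP e0^-1 x; last by exists 0.
  have xp : 0 < x by apply: lt_le_trans x0; rewrite invr_gt0.
  have [|E [a [b H]]] := ex x^-1; last by exists E => _; exists a, b.
  by rewrite invr_gt0 xp/= invf_ple// posrE.
have {ex}[E HE] := choice ex.
have main (x : R) : e0^-1 <= x -> size (oscillator x^-1 (E x)) = 4%N /\
    exists y, [/\ @almost_all_real_solution R[i] (oscillator x^-1 (E x)) y,
            ~~ odd #|` fset_set (@nonreal_zeros R[i] y)|
          & forall z, @nonreal_zeros R[i] y z -> @nonreal_zeros R[i] y (Num.conj z)].
  move=> x0; have [a [b [/andP[E0 E1] ab0 rec]]] := HE x x0.
  have xp : 0 < x by apply: lt_le_trans x0; rewrite invr_gt0.
  have xi0 : 0 < x^-1 by rewrite invr_gt0.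
  have xi1 : x^-1 <= 1 by apply: le_trans e01; rewrite invf_ple// posrE.
  split; first exact: size_oscillator.
  exists (sol x^-1 (E x) a%:C b%:C); split.
  - exact: almost_all_real_sol.
  - exact: even_nonreal_zeros.
  - exact: nonreal_zeros_conj.
exists (real_ray e0^-1), (fun z => oscillator (complex.Re z)^-1 (E (complex.Re z))); split.
- exact: curve_real_ray.
- exact: unbounded_real_ray.
- move=> z [x /=]; rewrite in_itv /= andbT => x0 <-.
  have [sz [y [h _ _]]] := main x x0; split => //; by exists y.
- exists (e0^-1)%:C; first by exists e0^-1 => //=; rewrite in_itv /= lexx.
  by have [_ [y H]] := main _ (lexx e0^-1); exists y.
Qed.
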